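(* Let $X\overset{f}{\leftarrow}Z\overset{g}{\rightarrow}Y$ be a minimal correspondence of curves over a field $k$ without a core, where $Z$ is hyperbolic or $k$ is an algebraic closure of $\mathbb{F}_p$ for some prime $p$. If the generic graph $\mathcal{G}_{gen}$ is a tree, then any maximal compact open subgroup $G$ of $A^{PQ}$ is conjugate in $A^{PQ}$ to either $G_P$ or $G_Q$.
   Context: A curve over a field $k$ is a smooth, geometrically integral $k$-scheme (separated, of finite type) of dimension 1; it is hyperbolic if $\mathrm{Aut}_{\overline{k}}(C_{\overline{k}})$ is finite (equivalently $2g-2+r\ge 1$ with $g$ the genus of the compactification and $r$ the number of geometric punctures). A correspondence of curves over $k$ is a diagram $X\overset{f}{\leftarrow}Z\overset{g}{\rightarrow}Y$ of curves over $k$ with $f,g$ finite, generically separable. Via $f^*,g^*$ regard $k(X),k(Y)\subset k(Z)$. It is minimal if no proper subfield of $k(Z)$ contains both $k(X)$ and $k(Y)$. It is without a core if $k(X)\cap k(Y)$ has transcendence degree 0 over $k$. Let $\Omega$ be an algebraically closed field of transcendence degree 1 over $k$. The full generic graph $\mathcal{G}_{gen}^{full}$ is the 2-colored graph whose blue vertices are the $k$-algebra embeddings $k(X)\to\Omega$, whose red vertices are the $k$-algebra embeddings $k(Y)\to\Omega$, and whose edges are the $k$-algebra embeddings $e:k(Z)\to\Omega$, where $e$ joins the blue vertex $e\circ f^*$ to the red vertex $e\circ g^*$. Fix a $k$-embedding $PQ:k(Z)\hookrightarrow\Omega$, and put $P=PQ\circ f^*$ (blue vertex), $Q=PQ\circ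 g^*$ (red vertex). The generic graph $\mathcal{G}_{gen}$ is the connected component of $\mathcal{G}_{gen}^{full}$ containing the edge $PQ$. $E_\infty\subset\Omega$ is the smallest subfield of $\Omega$ containing $PQ(k(Z))$ that is Galois (possibly infinite) over both $P(k(X))$ and $Q(k(Y))$; equivalently, it is the compositum in $\Omega$ of the images of all vertices and edges of $\mathcal{G}_{gen}$. Put $G_P=\mathrm{Gal}(E_\infty/P(k(X)))$ and $G_Q=\mathrm{Gal}(E_\infty/Q(k(Y)))$, subgroups of $\mathrm{Aut}_k(E_\infty)$; they act on $\mathcal{G}_{gen}$ by post-composition. $A^{PQ}$ is the subgroup of $\mathrm{Aut}_k(E_\infty)$ generated by $G_P$ and $G_Q$, with the topology induced from $\mathrm{Aut}_k(E_\infty)$, in which the pointwise stabilizers of finite subsets of $E_\infty$ form a neighborhood base of the identity (so $G_P$ and $G_Q$, with their profinite topologies, are compact open subgroups). *)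

(* Defs.v *)
From HB Require Import structures.
From Stdlib Require List.
From mathcomp Require Import all_boot all_order all_algebra all_field.
From mathcomp Require Import all_classical all_reals all_analysis.

Set Implicit Arguments.
Unset Strict Implicit.
Unset Printing Implicit Defensive.

Import GRing.Theory.

Local Open Scope classical_set_scope.
Local Open Scope ring_scope.

Definition prime_ideal (A : comPzRingType) (P : set A) : Prop :=
  [/\ P 0, ~ P 1, (forall a b, P a -> P b -> P (a + b)),
      (forall a b, P b -> P (a * b)) &
      (forall a b, P (a * b) -> P a \/ P b)].

Definition subring_generated (A : comPzRingType) (B : set A) : set A :=
  smallest (fun S : set A => GRing.subring_closed [in S]) B.

Definition finite_type_algebra (k : fieldType) (A : comPzRingType)
    (c : {rmorphism k -> A}) : Prop :=
  exists B : set A,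
    finite_set B /\ subring_generated (range c `|` B) = setT.

Definition finite_algebra (A B : comPzRingType) (h : {rmorphism A -> B}) : Prop :=
  exists (n : nat) (e : 'I_n -> B),
    forall b, exists a : 'I_n -> A, b = \sum_(i < n) h (a i) * e i.

(* Infinitesimal lifting along square-zero extensions of k-algebras. *)
Definition formally_smooth (k : fieldType) (A : comPzRingType)
    (c : {rmorphism k -> A}) : Prop :=
  forall (B C : comPzRingType) (cB : {rmorphism k -> B})
      (p : {rmorphism B -> C}) (h : {rmorphism A -> C}),
    (forall y, exists x, p x = y) ->
    (forall x y, p x = 0 -> p y = 0 -> x * y = 0) ->
    (forall a, h (c a) = p (cB a)) ->
    exists l : {rmorphism A -> B},
      (forall a, l (c a) = cB a) /\ (forall x, p (l x) = h x).

Record opens (X : topologicalType) :=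
  Opens { oset :> set X; oset_open : open oset }.

Definition fullO (X : topologicalType) : opens X := Opens (@openT X).

Definition preimO (X Y : topologicalType) (f : X -> Y) (cf : continuous f)
    (V : opens Y) : opens X :=
  Opens ((continuousP f).1 cf V (oset_open V)).

(* A topological space with a sheaf of commutative rings; the zero ring is
   allowed, as it is the ring of sections over the empty set. *)
Record ringed_space := RingedSpace {
  pt :> topologicalType;
  sec : opens pt -> comPzRingType;
  res : forall U V : opens pt, V `<=` U -> {rmorphism sec U -> sec V};
  res_id : forall (U : opens pt) (UU : U `<=` U) (s : sec U), res UU s = s;
  res_comp : forall (U V W : opens pt) (VU : V `<=` U) (WV : W `<=` V)
      (WU : W `<=` U) (s : sec U), res WV (res VU s) = res WU s;
  sheaf_sep : forall (U : opens pt) (s t : sec U),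
    (forall x, oset U x -> exists (V : opens pt) (VU : V `<=` U),
       oset V x /\ res VU s = res VU t) -> s = t;
  sheaf_glue : forall (I : Type) (V : I -> opens pt) (s : forall i, sec (V i)),
    (forall i j (W : opens pt) (Wi : W `<=` V i) (Wj : W `<=` V j),
       res Wi (s i) = res Wj (s j)) ->
    forall U : opens pt, oset U = \bigcup_i oset (V i) ->
    exists t : sec U, forall i (ViU : V i `<=` U), res ViU t = s i
}.

Arguments sec {r} U : rename.
Arguments res {r U V} VU : rename.

(* The germ of s at x is a unit of the stalk at x. *)
Definition unit_at (X : ringed_space) (U : opens X) (s : sec U) (x : X) : Prop :=
  exists (V : opens X) (VU : V `<=` U) (t : sec V),
    oset V x /\ res VU s * t = 1.

(* Every stalk is a local ring: 1 <> 0 and, for every a, a or 1 - a is a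
   unit. *)
Definition locally_ringed (X : ringed_space) : Prop :=
  forall (U : opens X) (x : X), oset U x ->
    (1 : sec U) <> 0 /\ forall s : sec U, unit_at s x \/ unit_at (1 - s) x.

Definition is_stalk (X : ringed_space) (x : X) (A : comPzRingType)
    (germ : forall U : opens X, oset U x -> {rmorphism sec U -> A}) : Prop :=
  [/\ (forall (U V : opens X) (VU : V `<=` U) (Ux : oset U x) (Vx : oset V x)
         (s : sec U), germ V Vx (res VU s) = germ U Ux s),
      (forall a : A, exists (U : opens X) (Ux : oset U x) (s : sec U),
         germ U Ux s = a) &
      (forall (U : opens X) (Ux : oset U x) (s : sec U), germ U Ux s = 0 ->
         exists (V : opens X) (VU : V `<=` U), oset V x /\ res VU s = 0)].

(* The canonical map from (U, O_X|U) to Spec O_X(U), which sends x to the prime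
   of sections that are not units at x, is an isomorphism: it is bijective, it
   is a homeomorphism, and O_X(U) -> O_X(D(s)) is the localization at s. *)
Definition affine_open (X : ringed_space) (U : opens X) : Prop :=
  [/\ (forall P : set (sec U), prime_ideal P ->
         exists! x : X, oset U x /\ P = [set s | ~ unit_at s x]),
      (forall x, oset U x -> prime_ideal [set s : sec U | ~ unit_at s x]),
      (forall (V : opens X) (x : X), V `<=` U -> oset V x ->
         exists s : sec U,
           unit_at s x /\ [set y | oset U y /\ unit_at s y] `<=` V) &
      (forall (s : sec U) (V : opens X) (VU : V `<=` U),
         oset V = [set y | oset U y /\ unit_at s y] ->
         [/\ (exists t, res VU s * t = 1),
             (forall t : sec V, exists (n : nat) (a : sec U),
                res VU s ^+ n * t = res VU a) &
             (forall a : sec U, res VU a = 0 ->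
                exists n : nat, s ^+ n * a = 0)])].

Record scheme := Scheme {
  scheme_space :> ringed_space;
  scheme_local : locally_ringed scheme_space;
  scheme_affine : forall x : scheme_space,
    exists U : opens scheme_space, oset U x /\ affine_open U
}.

(* A morphism X -> Spec k amounts to a sheaf of k-algebras on X. *)
Record kscheme (k : fieldType) := KScheme {
  kscheme_scheme :> scheme;
  cst : forall U : opens kscheme_scheme, {rmorphism k -> sec U};
  cst_res : forall (U V : opens kscheme_scheme) (VU : V `<=` U) (a : k),
    res VU (cst U a) = cst V a
}.

Arguments cst {k k0} U : rename.

Record mor (X Y : scheme) := Mor {
  mfun :> X -> Y;
  mcont : continuous mfun;
  pull : forall V : opens Y, {rmorphism sec V -> sec (preimO mcont V)};
  pull_res : forall (V W : opens Y) (WV : W `<=` V)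
      (WV' : preimO mcont W `<=` preimO mcont V) (s : sec V),
    pull W (res WV s) = res WV' (pull V s);
  pull_local : forall (V : opens Y) (s : sec V) (x : X), oset V (mfun x) ->
    unit_at (pull V s) x -> unit_at s (mfun x)
}.

Arguments mcont {X Y} m : rename.
Arguments pull {X Y} m V : rename.

(* Equality of morphisms; [res] identifies the two opens f^-1(V) and g^-1(V). *)
Definition eq_mor (X Y : scheme) (f g : mor X Y) : Prop :=
  (forall x, f x = g x) /\
  forall (V : opens Y) (fg : preimO (mcont g) V `<=` preimO (mcont f) V)
    (s : sec V), res fg (pull f V s) = pull g V s.

Section Composition.

Lemma res_unit_at (X : ringed_space) (U V : opens X) (VU : V `<=` U)
    (s : sec U) (x : X) : oset V x -> unit_at (res VU s) x <-> unit_at s x.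
Proof.
move=> Vx; split=> [[W [WV [t [Wx e]]]]|[W [WU [t [Wx e]]]]].
  have WU : W `<=` U := subset_trans WV VU.
  by exists W, WU, t; split=> //; rewrite -(res_comp VU WV WU).
pose W' : opens X := Opens (openI (oset_open W) (oset_open V)).
have W'V : W' `<=` V by move=> y [].
have W'W : W' `<=` W by move=> y [].
have W'U : W' `<=` U := subset_trans W'W WU.
exists W', W'V, (res W'W t); split=> //.
by rewrite (res_comp VU W'V W'U) -(res_comp WU W'W W'U) -rmorphM e rmorph1.
Qed.

Variable X : scheme.

Let cid : continuous (fun x : X => x). Proof. by move=> x. Qed.

Let sub_id (V : opens X) : preimO cid V `<=` V. Proof. by []. Qed.

Lemma idmor_res (V W : opens X) (WV : W `<=` V)
    (WV' : preimO cid W `<=` preimO cid V) (s : sec V) :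
  res (sub_id (V := W)) (res WV s) = res WV' (res (sub_id (V := V)) s).
Proof.
have H : preimO cid W `<=` V by exact: WV.
by rewrite (res_comp WV (@sub_id W) H) (res_comp (@sub_id V) WV' H).
Qed.

Lemma idmor_local (V : opens X) (s : sec V) (x : X) : oset V x ->
  unit_at (res (sub_id (V := V)) s) x -> unit_at s x.
Proof. by move=> Vx /res_unit_at; apply. Qed.

Definition idmor : mor X X :=
  @Mor X X (fun x => x) cid (fun V => res (sub_id (V := V)))
       idmor_res idmor_local.

Variables (Y Z : scheme) (g : mor Y Z) (f : mor X Y).

Let ccomp : continuous (fun x => g (f x)).
Proof. by move=> x; apply: continuous_comp; [exact: mcont | exact: mcont]. Qed.

Let sub_comp (V : opens Z) :
  preimO ccomp V `<=` preimO (mcont f) (preimO (mcont g) V).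
Proof. by []. Qed.

Definition compmor_pull (V : opens Z) :
    {rmorphism sec V -> sec (preimO ccomp V)} :=
  (res (sub_comp (V := V)) \o pull f (preimO (mcont g) V)) \o pull g V.

Lemma compmor_res (V W : opens Z) (WV : W `<=` V)
    (WV' : preimO ccomp W `<=` preimO ccomp V) (s : sec V) :
  compmor_pull W (res WV s) = res WV' (compmor_pull V s).
Proof.
rewrite /compmor_pull /=.
have H1 : preimO (mcont g) W `<=` preimO (mcont g) V by move=> y; exact: WV.
have H2 : preimO (mcont f) (preimO (mcont g) W) `<=`
          preimO (mcont f) (preimO (mcont g) V) by move=> y; exact: WV.
have H3 : preimO ccomp W `<=` preimO (mcont f) (preimO (mcont g) V) by exact: WV'.
by rewrite (pull_res WV H1) (pull_res H1 H2) (res_comp H2 _ H3) (res_comp _ WV' H3).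
Qed.

Lemma compmor_local (V : opens Z) (s : sec V) (x : X) : oset V (g (f x)) ->
  unit_at (compmor_pull V s) x -> unit_at s (g (f x)).
Proof.
move=> Vx /res_unit_at h; apply: pull_local => //.
by apply: pull_local => //; exact: h.
Qed.

Definition compmor : mor X Z := Mor compmor_res compmor_local.

End Composition.

(* f lies over the morphism Spec K -> Spec k given by i; with i = idfun, f is a
   morphism of k-schemes. *)
Definition over (k K : fieldType) (i : {rmorphism k -> K})
    (X : kscheme K) (Y : kscheme k) (f : mor X Y) : Prop :=
  forall (V : opens Y) (a : k),
    pull f V (cst V a) = cst (preimO (mcont f) V) (i a).

Definition kmor (k : fieldType) (X Y : kscheme k) (f : mor X Y) : Prop :=
  over idfun f.

(* XK with p : XK -> X is the fibre product of X and Spec K over Spec k. *)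
Definition is_base_change (k K : fieldType) (i : {rmorphism k -> K})
    (X : kscheme k) (XK : kscheme K) (p : mor XK X) : Prop :=
  over i p /\
  forall (T : kscheme K) (u : mor T X), over i u ->
    (exists v : mor T XK, kmor v /\ eq_mor (compmor p v) u) /\
    (forall v w : mor T XK, kmor v -> kmor w ->
       eq_mor (compmor p v) u -> eq_mor (compmor p w) u -> eq_mor v w).

Definition is_product (k : fieldType) (X Y P : kscheme k)
    (p : mor P X) (q : mor P Y) : Prop :=
  [/\ kmor p, kmor q &
  forall (T : kscheme k) (u : mor T X) (v : mor T Y), kmor u -> kmor v ->
    (exists w : mor T P,
       [/\ kmor w, eq_mor (compmor p w) u & eq_mor (compmor q w) v]) /\
    (forall w w' : mor T P, kmor w -> kmor w' ->
       eq_mor (compmor p w) u -> eq_mor (compmor q w) v ->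
       eq_mor (compmor p w') u -> eq_mor (compmor q w') v -> eq_mor w w')].

(* A homeomorphism onto a closed subset, with O_Y -> f_* O_X surjective. *)
Definition closed_immersion (X Y : scheme) (f : mor X Y) : Prop :=
  [/\ injective f, (forall A : set X, closed A -> closed (f @` A)) &
      forall (V : opens Y) (s : sec (preimO (mcont f) V)) (y : Y), oset V y ->
        exists (W : opens Y) (WV : preimO (mcont f) W `<=` preimO (mcont f) V)
          (t : sec W), [/\ W `<=` V, oset W y & pull f W t = res WV s]].

Definition separated (k : fieldType) (X : kscheme k) : Prop :=
  forall (P : kscheme k) (p q : mor P X) (d : mor X P),
    is_product p q -> kmor d ->
    eq_mor (compmor p d) (idmor X) -> eq_mor (compmor q d) (idmor X) ->
    closed_immersion d.

Definition finite_type (k : fieldType) (X : kscheme k) : Prop :=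
  exists (n : nat) (U : 'I_n -> opens X),
    (forall i, affine_open (U i) /\ finite_type_algebra (cst (U i))) /\
    (forall x, exists i, oset (U i) x).

Definition smooth (k : fieldType) (X : kscheme k) : Prop :=
  forall x : X, exists U : opens X,
    [/\ oset U x, affine_open U, finite_type_algebra (cst U) &
        formally_smooth (cst U)].

Definition integral_scheme (X : scheme) : Prop :=
  (exists x : X, True) /\
  forall U : opens X, (exists x, oset U x) ->
    (1 : sec U) <> 0 /\
    forall s t : sec U, s * t = 0 -> s = 0 \/ t = 0.

Definition geometrically_integral (k : fieldType) (X : kscheme k) : Prop :=
  forall (K : fieldType) (i : {rmorphism k -> K}) (XK : kscheme K)
    (p : mor XK X), is_base_change i p -> integral_scheme XK.

Definition irreducible_closed (X : topologicalType) (A : set X) : Prop :=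
  [/\ closed A, A !=set0 &
      forall B C : set X, closed B -> closed C -> A = B `|` C -> A = B \/ A = C].

Definition closed_chain (X : topologicalType) (n : nat) (c : 'I_n.+1 -> set X) :
    Prop :=
  (forall i, irreducible_closed (c i)) /\
  (forall i j : 'I_n.+1, (i < j)%N -> c i `<` c j).

Definition krull_dim (X : topologicalType) (n : nat) : Prop :=
  (exists c : 'I_n.+1 -> set X, closed_chain c) /\
  ~ (exists c : 'I_n.+2 -> set X, closed_chain c).

Definition curve (k : fieldType) (X : kscheme k) : Prop :=
  [/\ smooth X, geometrically_integral X, separated X, finite_type X &
      krull_dim X 1].

Definition finite_mor (X Y : scheme) (f : mor X Y) : Prop :=
  forall V : opens Y, affine_open V ->
    affine_open (preimO (mcont f) V) /\ finite_algebra (pull f V).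

Definition is_automorphism (k : fieldType) (X : kscheme k) (f : mor X X) : Prop :=
  kmor f /\ exists g : mor X X,
    [/\ kmor g, eq_mor (compmor f g) (idmor X) & eq_mor (compmor g f) (idmor X)].

Definition finite_Aut (k : fieldType) (X : kscheme k) : Prop :=
  exists (n : nat) (a : 'I_n -> mor X X),
    forall f : mor X X, is_automorphism f -> exists i, eq_mor f (a i).

Definition is_alg_closure (k K : fieldType) (i : {rmorphism k -> K}) : Prop :=
  GRing.closed_field_axiom K /\ forall x : K, algebraicOver i x.

Definition hyperbolic (k : fieldType) (X : kscheme k) : Prop :=
  forall (K : fieldType) (i : {rmorphism k -> K}) (XK : kscheme K)
    (p : mor XK X), is_alg_closure i -> is_base_change i p -> finite_Aut XK.

(* The stalk at the generic point, characterized as a filtered colimit. *)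
Record function_field (k : fieldType) (X : kscheme k) := FunctionField {
  ff :> fieldType;
  gpt : X;
  gptP : closure [set gpt] = setT;
  germ : forall U : opens X, oset U gpt -> {rmorphism sec U -> ff};
  germP : is_stalk germ
}.

Arguments germ {k X} f {U} Ugpt : rename.

Definition ffcst (k : fieldType) (X : kscheme k) (K : function_field X) :
    {rmorphism k -> K} :=
  germ K (U := fullO X) I \o cst (fullO X).

Record kemb (k K L : fieldType) (iK : {rmorphism k -> K})
    (iL : {rmorphism k -> L}) := Kemb {
  emb :> {rmorphism K -> L};
  emb_cst : forall a, emb (iK a) = iL a
}.

Lemma rmorph_eq (A B : pzSemiRingType) (f g : {rmorphism A -> B}) :
  (forall x, f x = g x) -> f = g.
Proof.
move=> /funext; case: f => f [[Hf0] [Hf]]; case: g => g [[Hg0] [Hg]] /= e.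
by subst g; rewrite (Prop_irrelevance Hf0 Hg0) (Prop_irrelevance Hf Hg).
Qed.

Lemma kemb_eq (k K L : fieldType) (iK : {rmorphism k -> K})
    (iL : {rmorphism k -> L}) (e e' : kemb iK iL) :
  (forall x, e x = e' x) -> e = e'.
Proof.
case: e e' => [f Hf] [g Hg] /= /rmorph_eq e.
by subst g; rewrite (Prop_irrelevance Hf Hg).
Qed.

Lemma kemb_comp_cst (k K L M : fieldType) (iK : {rmorphism k -> K})
    (iL : {rmorphism k -> L}) (iM : {rmorphism k -> M})
    (e : kemb iL iM) (h : kemb iK iL) (a : k) : (e \o h) (iK a) = iM a.
Proof. by rewrite /= !emb_cst. Qed.

Definition kemb_comp (k K L M : fieldType) (iK : {rmorphism k -> K})
    (iL : {rmorphism k -> L}) (iM : {rmorphism k -> M})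
    (e : kemb iL iM) (h : kemb iK iL) : kemb iK iM :=
  Kemb (emb := e \o h) (kemb_comp_cst e h).

Definition is_pullback (k : fieldType) (X Z : kscheme k) (f : mor Z X)
    (KX : function_field X) (KZ : function_field Z)
    (fs : kemb (ffcst KX) (ffcst KZ)) : Prop :=
  f (gpt KZ) = gpt KX /\
  forall (U : opens X) (Ux : oset U (gpt KX))
    (Uz : oset (preimO (mcont f) U) (gpt KZ)) (s : sec U),
    fs (germ KX Ux s) = germ KZ Uz (pull f U s).

Section Subfields.
Variable L : fieldType.
Implicit Types (F E S B : set L) (p : {poly L}) (x : L).

Definition is_subfield S : Prop := GRing.divring_closed [in S].

Definition algebraic_over F x : Prop :=
  exists p, [/\ p != 0, p \is a polyOver [in F] & root p x].

Definition adjoin F B : set L := smallest is_subfield (F `|` B).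

Definition transcendence_basis F E B : Prop :=
  [/\ B `<=` E, (forall b, B b -> ~ algebraic_over (adjoin F (B `\ b)) b) &
      (forall x, E x -> algebraic_over (adjoin F B) x)].

Definition has_trdeg F E (n : nat) : Prop :=
  exists B, (B #= `I_n)%card /\ transcendence_basis F E B.

Definition is_minpoly F x p : Prop :=
  [/\ p \is monic, p \is a polyOver [in F], root p x &
      forall q, q \is a polyOver [in F] -> root q x -> p %| q].

Definition separable_ext F E : Prop :=
  F `<=` E /\ forall x, E x -> exists2 p, is_minpoly F x p & separable_poly p.

Definition normal_ext F E : Prop :=
  F `<=` E /\ forall x, E x -> exists2 p, is_minpoly F x p &
    exists2 rs : seq L, (forall r, r \in rs -> E r) &
      p = \prod_(r <- rs) ('X - r%:P).

Definition galois_ext F E : Prop := separable_ext F E /\ normal_ext F E.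

Definition subfield_type S (HS : is_subfield S) : Type := {x : L | x \in S}.

HB.instance Definition _ S (HS : is_subfield S) :=
  SubChoice.on (subfield_type HS).
HB.instance Definition _ S (HS : is_subfield S) :=
  GRing.SubChoice_isSubIntegralDomain.Build L _ (subfield_type HS) HS.
HB.instance Definition _ S (HS : is_subfield S) :=
  [SubIntegralDomain_isSubField of subfield_type HS by <:].

End Subfields.

Definition generically_separable (k KX KZ : fieldType) (iX : {rmorphism k -> KX})
    (iZ : {rmorphism k -> KZ}) (fs : kemb iX iZ) : Prop :=
  separable_ext (range fs) setT.

Definition minimal (k KX KY KZ : fieldType) (iX : {rmorphism k -> KX})
    (iY : {rmorphism k -> KY}) (iZ : {rmorphism k -> KZ})
    (fs : kemb iX iZ) (gs : kemb iY iZ) : Prop :=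
  forall S : set KZ, is_subfield S -> range fs `<=` S -> range gs `<=` S ->
    S = setT.

Definition without_core (k KX KY KZ : fieldType) (iX : {rmorphism k -> KX})
    (iY : {rmorphism k -> KY}) (iZ : {rmorphism k -> KZ})
    (fs : kemb iX iZ) (gs : kemb iY iZ) : Prop :=
  has_trdeg (range iZ) (range fs `&` range gs) 0.

Definition is_Fp_bar (k : fieldType) : Prop :=
  exists p : nat, prime p /\ exists i : {rmorphism 'F_p -> k}, is_alg_closure i.

Record aut (L : fieldType) (F : set L) := FieldAut {
  aut_fun :> {rmorphism L -> L};
  aut_bij : bijective aut_fun;
  aut_fix : forall x, F x -> aut_fun x = x
}.

Section AutTheory.
Variables (L : fieldType) (F : set L).
Local Notation Aut := (aut F).

Lemma aut_eq (s t : Aut) : (forall x, s x = t x) -> s = t.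
Proof.
case: s t => [s Bs Fs] [t Bt Ft] /= /rmorph_eq e; subst t.
by rewrite (Prop_irrelevance Bs Bt) (Prop_irrelevance Fs Ft).
Qed.

HB.instance Definition _ := gen_eqMixin Aut.
HB.instance Definition _ := gen_choiceMixin Aut.

Definition aut1 : Aut :=
  @FieldAut L F idfun (Bijective (fun=> erefl) (fun=> erefl)) (fun _ _ => erefl).

Lemma autM_fix (s t : Aut) x : F x -> (s \o t) x = x.
Proof. by move=> Fx /=; rewrite !aut_fix. Qed.

Definition autM (s t : Aut) : Aut :=
  @FieldAut L F (s \o t) (bij_comp (aut_bij s) (aut_bij t)) (autM_fix s t).

Lemma autV_ex (s : Aut) : exists t : Aut, cancel t s /\ cancel s t.
Proof.
have [g gK sK] := aut_bij s.
have gB : zmod_morphism g.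
  by move=> x y; apply: (can_inj gK); rewrite rmorphB !sK.
have gM : monoid_morphism g.
  split; first by apply: (can_inj gK); rewrite sK rmorph1.
  by move=> x y; apply: (can_inj gK); rewrite rmorphM !sK.
pose g1 := GRing.isZmodMorphism.Build L L g gB.
pose g2 := GRing.isMonoidMorphism.Build L L g gM.
pose gr : {rmorphism L -> L} := HB.pack g g1 g2.
have Bg : bijective gr by exists s.
have Fg x : F x -> gr x = x.
  by move=> Fx; rewrite -{1}(aut_fix s Fx) /= gK.
by exists (FieldAut Bg Fg).
Qed.

Definition autV (s : Aut) : Aut := projT1 (cid (autV_ex s)).

Lemma autMA : associative autM. Proof. by move=> s t u; exact: aut_eq. Qed.
Lemma aut1M : left_id aut1 autM. Proof. by move=> s; exact: aut_eq. Qed.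
Lemma autM1 : right_id aut1 autM. Proof. by move=> s; exact: aut_eq. Qed.

Lemma autVM : left_inverse aut1 autV autM.
Proof.
by move=> s; apply: aut_eq => x; rewrite /autV /=; case: cid => t [/= _ ->].
Qed.

Lemma autMV : right_inverse aut1 autV autM.
Proof.
by move=> s; apply: aut_eq => x; rewrite /autV /=; case: cid => t [/= ->].
Qed.

HB.instance Definition _ := isGroup.Build Aut autMA aut1M autM1 autVM autMV.

(* Pointwise stabilizers of finite sets form a base of neighborhoods of 1:
   U is open if it contains, with s, a coset s * Stab(B) for some finite B. *)
Definition aut_open : set_system Aut :=
  [set U | forall s, U s -> exists B : seq L,
     forall t : Aut, (forall x, x \in B -> t x = x) -> U (s * t)%g].

Lemma aut_openT : aut_open setT. Proof. by move=> s _; exists [::]. Qed.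

Lemma aut_openI : setI_closed aut_open.
Proof.
move=> U V oU oV s [/oU [B HB] /oV [C HC]]; exists (B ++ C) => t tBC.
by split; [apply: HB | apply: HC] => x xB; apply: tBC; rewrite mem_cat xB ?orbT.
Qed.

Lemma aut_open_bigU (I : Type) (f : I -> set Aut) :
  (forall i, aut_open (f i)) -> aut_open (\bigcup_i f i).
Proof.
move=> of_ s [i _ /of_ [B HB]]; exists B => t tB.
by exists i => //; exact: HB.
Qed.

HB.instance Definition _ :=
  isOpenTopological.Build Aut aut_openT aut_openI aut_open_bigU.

Definition subgroup (H : set Aut) : Prop := group_closed [in H].

Definition generated (B : set Aut) : set Aut := smallest subgroup B.

Definition fixing (S : set L) : set Aut := [set s | forall x, S x -> s x = x].

Definition compact_open_subgroup (A G : set Aut) : Prop :=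
  [/\ subgroup G, G `<=` A, compact G &
      exists U : set Aut, open U /\ G = A `&` U].

Definition maximal_compact_open_subgroup (A G : set Aut) : Prop :=
  compact_open_subgroup A G /\
  forall H, compact_open_subgroup A H -> G `<=` H -> H = G.

Definition conjugate_in (A G H : set Aut) : Prop :=
  exists2 a : Aut, A a & G = [set (a * h * a^-1)%g | h in H].

End AutTheory.

Record graph := Graph {
  blue : Type;
  red : Type;
  edge : Type;
  bend : edge -> blue;
  rend : edge -> red
}.

Arguments bend {g} e : rename.
Arguments rend {g} e : rename.

Section Graphs.
Variable G : graph.

Definition vertex : Type := blue G + red G.

(* (e, true) is e from its blue to its red end, (e, false) the converse. *)
Definition dart : Type := edge G * bool.

Definition src (d : dart) : vertex :=
  if d.2 then inl (bend d.1) else inr (rend d.1).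
Definition tgt (d : dart) : vertex :=
  if d.2 then inr (rend d.1) else inl (bend d.1).

Fixpoint walk (v : vertex) (p : seq dart) (w : vertex) : Prop :=
  if p is d :: p' then src d = v /\ walk (tgt d) p' w else v = w.

Definition joined (v w : vertex) : Prop := exists p, walk v p w.

(* Edges must be distinct too, so that e, e^-1 is not a circuit while a pair of
   parallel edges is one. *)
Definition circuit (v : vertex) (p : seq dart) : Prop :=
  [/\ p <> [::], walk v p v, List.NoDup (map src p) &
      List.NoDup (map (fun d : dart => d.1) p)].

Definition is_tree : Prop :=
  [/\ inhabited vertex, (forall v w, joined v w) &
      ~ exists v p, circuit v p].

Lemma walk_rcons v p (d : dart) : walk v p (src d) -> walk v (rcons p d) (tgt d).
Proof. by elim: p v => [|d' p IH] v /= => [->|[-> /IH]]. Qed.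

Lemma joined_rend v (e : edge G) : joined v (inl (bend e)) -> joined v (inr (rend e)).
Proof. by move=> [p vp]; exists (rcons p (e, true)); exact: walk_rcons. Qed.

Definition component (v : vertex) : graph :=
  @Graph {b : blue G | joined v (inl b)} {r : red G | joined v (inr r)}
    {e : edge G | joined v (inl (bend e))}
    (fun e => exist _ (bend (sval e)) (svalP e))
    (fun e => exist _ (rend (sval e)) (joined_rend (svalP e))).

End Graphs.

Section Generic.
Variables (k KX KY KZ Omega : fieldType).
Variables (iX : {rmorphism k -> KX}) (iY : {rmorphism k -> KY}).
Variables (iZ : {rmorphism k -> KZ}) (iO : {rmorphism k -> Omega}).
Variables (fs : kemb iX iZ) (gs : kemb iY iZ) (PQ : kemb iZ iO).

Definition full_generic_graph : graph :=
  @Graph (kemb iX iO) (kemb iY iO) (kemb iZ iO)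
    (fun e => kemb_comp e fs) (fun e => kemb_comp e gs).

Definition vP : kemb iX iO := kemb_comp PQ fs.
Definition vQ : kemb iY iO := kemb_comp PQ gs.

Definition generic_graph : graph := @component full_generic_graph (inl vP).

Definition Einfty_set : set Omega :=
  smallest (fun E : set Omega =>
    [/\ is_subfield E, galois_ext (range vP) E & galois_ext (range vQ) E])
    (range PQ).

Lemma Einfty_subfield : is_subfield Einfty_set.
Proof.
split.
- by rewrite inE => E [[[]]]; rewrite inE.
- move=> x y; rewrite !inE => xE yE E CE.
  have [[[_ EB _] _ _] _] := CE.
  have := EB x y; rewrite !inE; apply; [exact: xE | exact: yE].
- move=> x y; rewrite !inE => xE yE E CE.
  have [[[_ _ EV] _ _] _] := CE.
  have := EV x y; rewrite !inE; apply; [exact: xE | exact: yE].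
Qed.

Definition Einfty : fieldType := subfield_type Einfty_subfield.

Definition Einfty_val (x : Einfty) : Omega := val x.

Definition AutkE := aut (Einfty_val @^-1` range iO).

Definition GP : set AutkE := @fixing _ _ (Einfty_val @^-1` range vP).
Definition GQ : set AutkE := @fixing _ _ (Einfty_val @^-1` range vQ).
Definition APQ : set AutkE := generated (GP `|` GQ).

End Generic.

Arguments GP {k KX KY KZ Omega iX iY iZ iO} fs gs PQ _.
Arguments GQ {k KX KY KZ Omega iX iY iZ iO} fs gs PQ _.
Arguments APQ {k KX KY KZ Omega iX iY iZ iO} fs gs PQ _.

(* Main.v *)
(* The group A = A^{PQ} is generated by the stabilizers G_P and G_Q, so the
   A-translates of P, Q and PQ form a connected graph, which embeds in the
   generic graph and hence is itself a tree; this makes it unnecessary to know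
   that A acts transitively on the edges of the generic graph.  A compact
   subgroup G of A has a bounded orbit of vertices, as the stabilizer of P is
   open, so it permutes the at most two centres of that orbit, and fixes them
   since it preserves the colouring.  Thus G lies in the stabilizer of a
   translate of P or Q, which is conjugate to G_P or G_Q.  These stabilizers
   are compact because Omega, of transcendence degree 1 over k, is algebraic
   over every embedded copy of k(X) or k(Y), and open because k(X) and k(Y) are
   finitely generated over k; so G equals the stabilizer when it is maximal. *)
From HB Require Import structures.
From Stdlib Require FinFun.
Require Import Defs.
From mathcomp Require Import all_boot all_order all_algebra all_field.
From mathcomp Require Import all_classical all_reals all_analysis.

Set Implicit Arguments.
Unset Strict Implicit.
Unset Printing Implicit Defensive.

Import GRing.Theory.

Local Open Scope classical_set_scope.
Local Open Scope ring_scope.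

(** * Fixed vertices in trees *)

Section Walks.
Variable T : graph.
Implicit Types (d e : dart T) (p q : seq (dart T)) (v w : vertex T).

Definition dart_inv d : dart T := (d.1, ~~ d.2).

Lemma dart_invK : involutive dart_inv.
Proof. by case=> x b; rewrite /dart_inv /= negbK. Qed.

Lemma src_inv d : src (dart_inv d) = tgt d. Proof. by case: d => x []. Qed.

Lemma tgt_inv d : tgt (dart_inv d) = src d. Proof. by case: d => x []. Qed.

Lemma walk_cat v p q w :
  walk v (p ++ q) w <-> exists u, walk v p u /\ walk u q w.
Proof.
elim: p v => [|d p IH] v /=; first by split=> [?|[u [->]]]; [exists v|].
split=> [[sd /IH [u [? ?]]]|[u [[sd ?] ?]]]; first by exists u.
by split=> //; apply/IH; exists u.
Qed.

Definition walk_rev p : seq (dart T) := rev (map dart_inv p).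

Lemma size_walk_rev p : size (walk_rev p) = size p.
Proof. by rewrite size_rev size_map. Qed.

Lemma walk_revP v p w : walk v p w -> walk w (walk_rev p) v.
Proof.
elim: p v => [|d p IH] v /=; first by move=> ->.
move=> [<- /IH h]; rewrite /walk_rev /= rev_cons -cats1; apply/walk_cat.
by exists (tgt d); split=> //=; rewrite src_inv tgt_inv.
Qed.

Lemma same_edge d e : e.1 = d.1 -> e = d \/ e = dart_inv d.
Proof.
by case: d e => x b [y c] /= ->; case: b c => [] []; auto.
Qed.

(** Returning along a parallel edge counts as a turn, in accordance with [circuit]. *)
Definition turns d e : bool := `[< e <> dart_inv d >].

Definition reduced p : bool := sorted turns p.

Lemma turnsP d e : reflect (e <> dart_inv d) (turns d e).
Proof. exact: asboolP. Qed.

Lemma turns_inv d e : turns (dart_inv e) (dart_inv d) = turns d e.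
Proof.
by apply/turnsP/turnsP => h E; apply: h; rewrite E ?dart_invK.
Qed.

Lemma reduced_rev p : reduced (walk_rev p) = reduced p.
Proof.
rewrite /reduced /walk_rev rev_sorted sorted_map.
by case: p => // d p /=; apply: eq_path => x y /=; rewrite turns_inv.
Qed.

Lemma reduced_catl p q : reduced (p ++ q) -> reduced p.
Proof. by case: p => //= d p; rewrite /reduced /= cat_path => /andP[]. Qed.

Lemma reduced_catr p q : reduced (p ++ q) -> reduced q.
Proof.
case: p => //= d p; rewrite /reduced /= cat_path => /andP[_].
exact: path_sorted.
Qed.

Lemma reduced_rcat d e p q : reduced (rcons p d) -> reduced (e :: q) ->
  turns d e -> reduced (rcons p d ++ e :: q).
Proof.
case: p => [|c p] /=; rewrite /reduced /=; first by move=> _ -> ->.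
by rewrite cat_path last_rcons /= => -> -> ->.
Qed.

(** A dart put in front of a reduced walk either keeps it reduced or cancels against its first
    dart. *)
Lemma walk_reduce v p w : walk v p w ->
  exists q, [/\ walk v q w, reduced q & (size q <= size p)%N].
Proof.
elim: p v => [|d p IH] v /=; first by exists [::].
move=> [<- /IH [q [wq rq sq]]].
case: (pselect (exists q', q = dart_inv d :: q')) => [[q' eq]|nq].
  subst q; case: wq => _; rewrite tgt_inv => wq; exists q'; split=> //.
    exact: path_sorted rq.
  by rewrite -ltnS ltnW // ltnS ltnW.
exists (d :: q); split=> //; case: q nq rq {wq sq} => //= e q nq ->.
by rewrite andbT; apply/turnsP => eq; apply: nq; exists q; rewrite eq.
Qed.

Lemma In_map_split (A : Type) (x : A) (B : Type) (f : B -> A) (s : seq B) :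
  List.In x (map f s) -> exists s1 y s2, s = s1 ++ y :: s2 /\ f y = x.
Proof.
elim: s => //= y s IH [<-|/IH [s1 [z [s2 [-> <-]]]]]; first by exists [::], y, s.
by exists (y :: s1), z, s2.
Qed.

(** Darts on one edge are equal or opposite. Equal ones repeat a source. Opposite ones are either
    consecutive, which reducedness forbids, or the second shares its source with the dart following
    the first. *)
Lemma NoDup_edges v p w : walk v p w -> reduced p ->
  List.NoDup (map (@src T) p) -> List.NoDup (map (fun d : dart T => d.1) p).
Proof.
elim: p v => [|d p IH] v /=; first by move=> *; constructor.
move=> [_ wp] rp /List.NoDup_cons_iff [nd ndp]; constructor; last first.
  exact: IH wp (path_sorted rp) ndp.
move=> h; have [p1 [e [p2 [pE ed]]]] := In_map_split h; apply: nd; rewrite pE.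
have [eE|eE] := same_edge ed.
  by rewrite map_cat /= eE; apply/List.in_or_app; right; left.
case: p1 pE => [|c p1] pE; rewrite {}pE /= in wp rp ndp.
  by case/andP: rp => /turnsP.
case: wp => sc _; move/List.NoDup_cons_iff: ndp => [+ _].
rewrite sc -src_inv -eE => nse.
by exfalso; apply: nse; rewrite map_cat; apply/List.in_or_app; right; left.
Qed.

Lemma dup_src p : ~ List.NoDup (map (@src T) p) ->
  exists p1 d p2 e p3, p = p1 ++ (d :: p2) ++ e :: p3 /\ src e = src d.
Proof.
elim: p => [|d p IH] /=; first by case; constructor.
have [h _|nd ndp] :=
    pselect (List.In (src d) (map (@src T) p)).
  by have [p2 [e [p3 [-> se]]]] := In_map_split h; exists [::], d, p2, e, p3.
have /IH [p1 [d' [p2 [e [p3 [-> se]]]]]] : ~ List.NoDup (map (@src T) p).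
  by move=> h; apply: ndp; constructor.
by exists (d :: p1), d', p2, e, p3.
Qed.

(* A shortest nonempty closed reduced walk is a circuit: its sources are
   distinct by minimality, and then two darts on the same edge would be
   consecutive and opposite. *)
Lemma closed_reduced_circuit v p : walk v p v -> reduced p -> p <> [::] ->
  exists u q, circuit u q.
Proof.
have [n sp] := ubnP (size p); elim: n v p sp => // n IH v p sp wp rp p0.
have [nd|/dup_src[p1 [d [p2 [e [p3 [pE se]]]]]]] :=
    pselect (List.NoDup (map (@src T) p)).
  by exists v, p; split=> //; exact: NoDup_edges wp rp nd.
move: wp rp sp; rewrite pE.
move=> /walk_cat[u [_ /walk_cat[u' [wd [eu' _]]]]] /reduced_catr/reduced_catl rd sp.
have du : src d = u by case: wd.
have {}wd : walk u (d :: p2) u by rewrite -{2}du -se eu'.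
apply: IH wd rd _ => //; apply: leq_trans (ltnSE sp).
by rewrite !size_cat /= addnCA -[X in (X < _)%N]addn0 ltn_add2l addnS.
Qed.

Hypothesis acyclic : ~ exists v p, circuit v p.

Lemma reduced_closed v p : walk v p v -> reduced p -> p = [::].
Proof.
move=> wp rp; apply: contrapT => p0; apply: acyclic.
exact: closed_reduced_circuit wp rp p0.
Qed.

(** Where two reduced walks first diverge, the reversal of one remainder followed by the other
    remainder is reduced, closed and nonempty. *)
Lemma reduced_unique v w p q :
  walk v p w -> walk v q w -> reduced p -> reduced q -> p = q.
Proof.
elim: p v q => [|d p IH] v q /=.
  by move=> -> wq _ rq; rewrite (reduced_closed wq rq).
move=> [sv wp]; case: q => [|e q] /=.
  by move=> vw rp _; apply: (@reduced_closed w) => //; split; rewrite // sv.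
move=> [se wq] rp rq; have [eqde|de] := pselect (e = d).
  by subst e; rewrite (IH _ _ wp wq (path_sorted rp) (path_sorted rq)).
have : walk_rev (d :: p) ++ e :: q = [::]; last first.
  by move/(congr1 size); rewrite size_cat addnS.
apply: (@reduced_closed w).
  by apply/walk_cat; exists v; split; [apply: (@walk_revP v (d :: p))|].
have := reduced_rev (d :: p); rewrite /reduced /= rp /walk_rev /= rev_cons => rrp.
by apply: reduced_rcat => //; apply/turnsP; rewrite dart_invK.
Qed.

Lemma reduced_shortest v w p q :
  walk v p w -> walk v q w -> reduced p -> (size p <= size q)%N.
Proof.
move=> wp /walk_reduce [q' [wq rq' sq]] rp.
by rewrite (reduced_unique wp wq rp rq').
Qed.

Hypothesis connected : forall v w : vertex T, joined v w.

Lemma joined_reduced v w : exists p, walk v p w /\ reduced p.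
Proof.
by have [p /walk_reduce[q [wq rq _]]] := connected v w; exists q.
Qed.

Definition is_blue v : bool := if v is inl _ then true else false.

Lemma src_tgt_colour d : is_blue (tgt d) = ~~ is_blue (src d).
Proof. by case: d => x []. Qed.

Definition within (S : set (vertex T)) (n : nat) (v : vertex T) : Prop :=
  forall s, S s -> exists p, walk v p s /\ (size p <= n)%N.

(** The new centre is the neighbour [tgt d] of [v] on the way to [w]. The reduced walk from it to a
    point of [S] either becomes the reduced walk from [v] when [d] is put in front, or starts by
    returning to [v] and then is a tail of the reduced walk from [w]. Either way at least one dart
    is saved. *)
Lemma within_shrink (S : set (vertex T)) n v w : S !=set0 ->
  within S n v -> within S n w -> v <> w -> is_blue v = is_blue w ->
  exists2 m, (m < n)%N & exists u, within S m u.
Proof.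
move=> [s0 Ss0] Sv Sw vw cvw; have [p [wp rp]] := joined_reduced v w.
(* Adjacent vertices differ in colour, so the walk from [v] to [w] has at least two darts. *)
case: p wp rp => [|d [|e p]] //=; first by move=> [dv dw] _; move: cvw;
  rewrite -dv -dw src_tgt_colour; case: (is_blue _).
move=> [dv [ed wp]] /andP[/turnsP de rp].
have near s : S s -> exists q, walk (tgt d) q s /\ (size q < n)%N.
  move=> Ss; have [q [wq rq]] := joined_reduced (tgt d) s; exists q; split=> //.
  have [rdq|rdq] := boolP (reduced (d :: q)).
    have [r [wr sr]] := Sv s Ss; apply: leq_trans sr.
    by apply: (@reduced_shortest v s (d :: q)).
  have [r [wr sr]] := Sw s Ss; apply: leq_trans sr.
  case: q wq rq rdq => [|c q] //= [sc wq] rq; rewrite /reduced /= rq andbT.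
  move=> /turnsP/contrapT cE.
  apply: leq_trans (_ : size (walk_rev (e :: p) ++ c :: q) <= _)%N.
    by rewrite size_cat /= size_walk_rev /= addSn ltnS leq_addl.
  apply: (@reduced_shortest w s) => //.
    by apply/walk_cat; exists (tgt d); split; [apply: (@walk_revP _ (e :: p))|].
  have := reduced_rev (e :: p); rewrite /reduced /= rp /walk_rev /= rev_cons => rrp.
  apply: reduced_rcat => //.
  by apply/turnsP; rewrite dart_invK cE => /esym.
(* As [S] is nonempty, the strict bound by [n] forces [n] to be positive. *)
case: n near {Sv Sw} => [|n] near; first by have [? []] := near _ Ss0.
by exists n => //; exists (tgt d) => s /near[q [? ?]]; exists q.
Qed.

End Walks.

(** * Morphisms of graphs and fixed vertices *)

Record graph_hom (T U : graph) := GraphHom {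
  hom_blue : blue T -> blue U;
  hom_red : red T -> red U;
  hom_edge : edge T -> edge U;
  hom_bend : forall e, bend (hom_edge e) = hom_blue (bend e);
  hom_rend : forall e, rend (hom_edge e) = hom_red (rend e)
}.

Section GraphHom.
Variables (T U : graph) (h : graph_hom T U).

Definition hom_vertex (v : vertex T) : vertex U :=
  match v with inl b => inl (hom_blue h b) | inr r => inr (hom_red h r) end.

Definition hom_dart (d : dart T) : dart U := (hom_edge h d.1, d.2).

Lemma src_hom d : src (hom_dart d) = hom_vertex (src d).
Proof. by case: d => e [] /=; rewrite /src /= ?hom_bend ?hom_rend. Qed.

Lemma tgt_hom d : tgt (hom_dart d) = hom_vertex (tgt d).
Proof. by case: d => e [] /=; rewrite /tgt /= ?hom_bend ?hom_rend. Qed.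

Lemma walk_hom v p w : walk v p w ->
  walk (hom_vertex v) (map hom_dart p) (hom_vertex w).
Proof.
by elim: p v => [|d p IH] v /=; [move=> -> | rewrite src_hom tgt_hom => -[-> /IH]].
Qed.

Lemma joined_hom v w : joined v w -> joined (hom_vertex v) (hom_vertex w).
Proof. by move=> [p /walk_hom wp]; exists (map hom_dart p). Qed.

Lemma circuit_hom v p :
  injective (hom_blue h) -> injective (hom_red h) -> injective (hom_edge h) ->
  circuit v p -> circuit (hom_vertex v) (map hom_dart p).
Proof.
move=> ib ir ie [p0 wp ns ne].
have iv : injective hom_vertex by case=> [x|x] [y|y] //= [] => [/ib|/ir] ->.
split; [by case: (p) p0 | exact: walk_hom | |].
  rewrite -map_comp (eq_map (g := hom_vertex \o @src T)) ?map_comp.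
    exact: FinFun.Injective_map_NoDup.
  exact: src_hom.
by rewrite -map_comp (map_comp (hom_edge h)); exact: FinFun.Injective_map_NoDup.
Qed.

End GraphHom.

(* The vertices minimizing the radius of S are at most two, and of different
   colours if they are two. *)
Lemma tree_fixed_vertex (T : graph) (H : set (graph_hom T T)) (S : set (vertex T)) :
  ~ (exists v p, @circuit T v p) ->
  (forall v w : vertex T, joined v w) ->
  S !=set0 -> (exists n v, within S n v) ->
  (forall h, H h -> S `<=` hom_vertex h @` S) ->
  exists v, forall h, H h -> hom_vertex h v = v.
Proof.
move=> acyclic conn S0 bounded HS.
have ex : exists n, `[< exists v, within S n v >].
  by case: bounded => n bn; exists n; apply/asboolP.
case: (ex_minnP ex) => n /asboolP[v Sv] nmin; exists v => h Hh.
apply: contrapT => hv.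
have [||m mn Sm] := @within_shrink T acyclic conn S n _ _ S0 _ Sv hv; last first.
- by have := nmin m (asboolT Sm); rewrite leqNgt mn.
- by case: (v).
(* Each point of [S] is the image of a point of [S], so the image of a walk from [v] reaches it from
   the image of [v], which is therefore a centre of the same radius. *)
move=> s /(HS h Hh) [s' /Sv[p [wp sp]] <-].
by exists (map (hom_dart h) p); split; [exact: walk_hom | rewrite size_map].
Qed.

(** * Algebraicity over a transcendental subfield *)

Lemma roots_seq (E : fieldType) (p : {poly E}) : p != 0 ->
  exists rs : seq E, forall y, root p y -> y \in rs.
Proof.
have [n] := ubnP (size p); elim: n p => // n IH p sp p0.
have [[a pa]|nr] := pselect (exists a, root p a); last first.
  by exists [::] => y py; case: nr; exists y.
have [q pE] := factor_theorem _ _ pa.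
have q0 : q != 0 by apply: contraNneq p0 => q0; rewrite pE q0 mul0r.
have [|//|rs rsP] := IH q.
  by move: sp; rewrite pE size_Mmonic ?monicXsubC // size_XsubC addn2.
exists (a :: rs) => y; rewrite pE rootM root_XsubC inE => /orP[/rsP ->|->//].
by rewrite orbT.
Qed.

Lemma subset_polyOver (L : fieldType) (S S' : set L) (p : {poly L}) (j : nat) :
  S `<=` S' -> is_subfield S' -> p \is a polyOver [in S] -> S' p`_j.
Proof.
move=> SS' S'f /allP pS; have [jp|jp] := ltnP j (size p).
  by apply: SS'; have := pS _ (mem_nth 0 jp); rewrite inE.
have [S'1 S'B _] := S'f.
by rewrite nth_default // -(subrr 1); have := S'B 1 1 S'1 S'1; rewrite inE.
Qed.

Section Exchange.
Variables (k L : fieldType) (i : {rmorphism k -> L}).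

Definition peval (b : L) : {poly k} -> L := horner_eval b \o map_poly i.

HB.instance Definition _ b := GRing.RMorphism.on (peval b).

Lemma pevalC b c : peval b c%:P = i c.
Proof. by rewrite /peval /= map_polyC /horner_eval hornerC. Qed.

Lemma pevalX b : peval b 'X = b.
Proof. by rewrite /peval /= map_polyX /horner_eval hornerX. Qed.

(** This is $k(b)$, written out so that denominators can be cleared. *)
Definition fractions_at (b : L) : set L :=
  [set y | exists u v, peval b v != 0 /\ y = peval b u / peval b v].

Lemma fractions_subfield b : is_subfield (fractions_at b).
Proof.
split.
- by rewrite inE; exists 1, 1; rewrite rmorph1 oner_neq0 divr1.
- move=> x y; rewrite !inE => -[u [v [v0 ->]]] [u' [v' [v'0 ->]]].
  exists (u * v' - u' * v), (v * v'); rewrite !(rmorphB, rmorphM) mulf_neq0 //.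
  by rewrite -(mulNr _ (peval b v')^-1) addf_div // mulNr.
- move=> x y; rewrite !inE => -[u [v [v0 ->]]] [u' [v' [v'0 ->]]].
  have [u'0|u'0] := eqVneq (peval b u') 0.
    exists 0, 1; rewrite rmorph1 oner_neq0; split=> //.
    by rewrite u'0 rmorph0 !mul0r invr0 mulr0.
  exists (u * v'), (v * u'); rewrite !rmorphM mulf_neq0 //; split=> //.
  by rewrite invf_div mulf_div.
Qed.

Lemma adjoin_fractions b B : B `<=` [set b] ->
  adjoin (range i) B `<=` fractions_at b.
Proof.
move=> Bb; apply: smallest_sub; first exact: fractions_subfield.
move=> _ [[c _ <-]|/Bb ->].
  by exists c%:P, 1; rewrite rmorph1 oner_neq0 divr1 pevalC.
by exists 'X, 1; rewrite rmorph1 oner_neq0 divr1 pevalX.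
Qed.

Lemma clear_denominators b (p : {poly L}) :
  (forall j, fractions_at b p`_j) ->
  exists v P, peval b v != 0 /\ peval b v *: p = map_poly (peval b) P.
Proof.
elim/poly_ind: p => [_|p c IH pc].
  by exists 1, 0; rewrite rmorph1 oner_neq0 scaler0 rmorph0.
have [|v [P [v0 vP]]] := IH; first by move=> j; have := pc j.+1;
  rewrite coefD coefMX coefC addr0.
have [u [w [w0]]] := pc 0; rewrite coefD coefMX coefC add0r /= => cE.
(* [v] clears the higher coefficients and [w] is the denominator of the constant one. *)
exists (v * w), (w%:P * P * 'X + (v * u)%:P); rewrite rmorphM mulf_neq0 //.
split=> //; rewrite rmorphD !rmorphM /= !map_polyC map_polyX /= -vP scalerDr.
congr (_ + _).
  by rewrite -!mul_polyC rmorphM !mulrA [_%:P * _%:P]mulrC.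
by rewrite cE -mul_polyC -!polyCM mulrACA divff // mulr1.
Qed.

(* Read a relation for t over k(b), after clearing denominators, as a
   polynomial in b with coefficients in k[t]; these do not all vanish since t
   is transcendental. *)
Lemma transcendence_exchange b t (p : {poly L}) : p != 0 ->
  (forall j, fractions_at b p`_j) -> root p t -> ~ algebraicOver i t ->
  exists2 q, map_poly (peval t) q != 0 & root (map_poly (peval t) q) b.
Proof.
move=> p0 /clear_denominators[v [P [v0 vP]]] pt nt; exists (swapXY P); last first.
  have mapE (Q : {poly {poly k}}) c :
      map_poly (peval c) Q = map_poly (horner_eval c) (map_poly (map_poly i) Q).
    by rewrite -map_poly_comp.
  have : root (map_poly (peval b) P) t by rewrite -vP rootZ.
  by rewrite /root !mapE -!horner_swapXY -!swapXY_map horner2_swapXY swapXYK.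
have : swapXY P != 0.
  rewrite swapXY_eq0; apply: contraNneq p0 => P0; move/eqP: vP.
  by rewrite P0 rmorph0 scaler_eq0 (negbTE v0).
apply: contraNneq => tP; apply/eqP/polyP => j; rewrite coef0.
have /polyP/(_ j) := tP; rewrite coef_map coef0 /= => tPj.
apply: contrapT => /eqP Pj; apply: nt; exists (swapXY P)`_j => //.
by rewrite /root -/(horner_eval _ _) -[X in X == _]/(peval _ _) tPj.
Qed.

End Exchange.

Lemma algebraicOver_trans (F E : fieldType) (f : {rmorphism F -> E}) (p : {poly E})
    (u : E) :
  p != 0 -> (forall j, algebraicOver f p`_j) -> root p u -> algebraicOver f u.
Proof.
move=> p0 pa pu; apply/integral_algebraic; apply: integral_root p0 pu _.
by apply/integral_poly => j; apply/integral_algebraic.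
Qed.

Lemma algebraicOver_subfield (F E : fieldType) (f : {rmorphism F -> E}) :
  is_subfield [set u | algebraicOver f u].
Proof.
split; first by rewrite inE; exact: algebraic1.
  by move=> x y; rewrite !inE; exact: algebraic_sub.
by move=> x y; rewrite !inE; exact: algebraic_div.
Qed.

(** The image of [t] is transcendental over [k], so by exchange the element [b] of a transcendence
    basis is algebraic over the image of [K], while [L] is algebraic over $k(b)$. *)
Lemma trdeg1_algebraic (k K L : fieldType) (iK : {rmorphism k -> K})
    (iL : {rmorphism k -> L}) (x : kemb iK iL) (t : K) :
  has_trdeg (range iL) setT 1 -> ~ algebraicOver iK t ->
  forall u : L, algebraicOver x u.
Proof.
move=> [B [Bcard [_ _ Balg]]] nt u.
have [b Bb] : exists b, B `<=` [set b].
  (* For an empty [B] any singleton will do, and 0 is the default. *)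
  have [[b Bb]|B0] := pselect (B !=set0); last first.
    by exists 0 => y By; case: B0; exists y.
  have /card_set_bijP[f [fun_f inj_f _]] := Bcard; exists b => y By.
  have f0 z : B z -> f z = 0%N by move=> /fun_f; rewrite II1.
  by apply: inj_f; rewrite ?inE // !f0.
have xt : ~ algebraicOver iL (x t).
  move=> [p p0]; rewrite (_ : map_poly iL p = map_poly x (map_poly iK p)).
    by rewrite fmorph_root => pt; apply: nt; exists p.
  by rewrite -map_poly_comp; apply: eq_map_poly => c; rewrite /= emb_cst.
have [p [p0 pover pt]] := Balg (x t) I.
have {}pover j : fractions_at iL b p`_j.
  by apply: subset_polyOver pover;
    [exact: adjoin_fractions | exact: fractions_subfield].
have [q q0 qb] := transcendence_exchange p0 pover pt xt.
(* The coefficients of the equation [q] for [b] lie in $k[x(t)]$, hence in the image of [x]. *)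
have ball : algebraicOver x b.
  apply: algebraicOver_trans q0 _ qb => j; rewrite coef_map /=.
  rewrite (_ : peval _ _ _ = x (map_poly iK q`_j).[t]); first exact: algebraic_id.
  rewrite -horner_map -map_poly_comp /peval /= /horner_eval; congr _.[_].
  by apply: eq_map_poly => c; rewrite /= emb_cst.
have [r [r0 rover ru]] := Balg u I.
apply: algebraicOver_trans r0 _ ru => j.
(* The elements algebraic over [x] form a subfield containing [k] and [b], hence all coefficients of
   [r]. *)
apply: (@subset_polyOver L _ [set y | algebraicOver x y] _ _ _ _ rover);
  last exact: algebraicOver_subfield.
apply: smallest_sub; first exact: algebraicOver_subfield.
move=> _ [[c _ <-]|/Bb -> //]; rewrite /= -(emb_cst x); exact: algebraic_id.
Qed.

(** * Function fields of curves *)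

Section EqMor.
Variables (X Y : scheme).
Implicit Types f g h : mor X Y.

Lemma eq_mor_sym f g : eq_mor f g -> eq_mor g f.
Proof.
move=> [fg pfg]; split=> [x|V gf s]; first by rewrite fg.
have sub : preimO (mcont g) V `<=` preimO (mcont f) V by move=> x; rewrite /= fg.
rewrite -(pfg V sub) (res_comp sub gf (@subset_refl _ _)); exact: res_id.
Qed.

Lemma eq_mor_trans f g h : eq_mor f g -> eq_mor g h -> eq_mor f h.
Proof.
move=> [fg pfg] [gh pgh]; split=> [x|V fh s]; first by rewrite fg.
have sub_fg : preimO (mcont g) V `<=` preimO (mcont f) V by move=> x; rewrite /= fg.
have sub_gh : preimO (mcont h) V `<=` preimO (mcont g) V by move=> x; rewrite /= gh.
by rewrite -(pgh V sub_gh) -(pfg V sub_fg); apply/esym/res_comp.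
Qed.

Lemma comp_idmor f : eq_mor (compmor (idmor Y) f) f.
Proof.
split=> // V fg s; rewrite /= /compmor_pull /=.
have sub : preimO (mcont f) (preimO (mcont (idmor Y)) V) `<=` preimO (mcont f) V by [].
rewrite (pull_res _ sub).
have sub' : preimO (mcont (compmor (idmor Y) f)) V `<=` preimO (mcont f) V by [].
rewrite (res_comp _ _ sub') (res_comp sub' fg (@subset_refl _ _)); exact: res_id.
Qed.

End EqMor.

(** Allows geometric integrality to be applied to [X] itself. *)
Lemma base_change_id (k : fieldType) (X : kscheme k) :
  is_base_change idfun (idmor X).
Proof.
split=> [V a|T u ou]; first exact: Defs.cst_res.
split=> [|v w _ _ vu wu]; first by exists u; split=> //; exact: comp_idmor.
apply: eq_mor_trans (eq_mor_sym (comp_idmor v)) _.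
by apply: eq_mor_trans vu _; apply: eq_mor_trans (eq_mor_sym wu) (comp_idmor w).
Qed.

Lemma basic_open_open (X : ringed_space) (U : opens X) (s : sec U) :
  open [set y | oset U y /\ unit_at s y].
Proof.
rewrite openE => y [Uy [V [VU [t [Vy e]]]]].
apply: filterS (open_nbhs_nbhs (conj (oset_open V) Vy)) => z Vz.
by split; [exact: (VU z) | exists V, VU, t].
Qed.

(** The distinguished open $D(s)$ when [U] is affine. *)
Definition basic_open (X : ringed_space) (U : opens X) (s : sec U) : opens X :=
  Opens (basic_open_open s).

Lemma basic_open_sub (X : ringed_space) (U : opens X) (s : sec U) :
  basic_open s `<=` U.
Proof. by move=> y []. Qed.

Section FunctionField.
Variables (k : fieldType) (X : kscheme k) (K : function_field X).

Lemma gpt_open (U : opens X) x : oset U x -> oset U (gpt K).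
Proof.
move=> Ux; have : closure [set gpt K] x by rewrite gptP.
by move=> /(_ U (open_nbhs_nbhs (conj (oset_open U) Ux)))[y [/= ->]].
Qed.

Lemma germ_res (U V : opens X) (VU : V `<=` U) (Ug : oset U (gpt K))
    (Vg : oset V (gpt K)) (s : sec U) : germ K Vg (res VU s) = germ K Ug s.
Proof. by case: (germP K) => h _ _; exact: h. Qed.

Lemma germ_eq0 (U : opens X) (Ug : oset U (gpt K)) (s : sec U) :
  germ K Ug s = 0 ->
  exists (V : opens X) (VU : V `<=` U), oset V (gpt K) /\ res VU s = 0.
Proof. by case: (germP K) => _ _ h; exact: h. Qed.

Lemma germ_surj a : exists (U : opens X) (Ug : oset U (gpt K)) (s : sec U),
  germ K Ug s = a.
Proof. by case: (germP K) => _ h _; exact: h. Qed.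

Lemma germ_cst (U : opens X) (Ug : oset U (gpt K)) (c : k) :
  germ K Ug (Defs.cst U c) = ffcst K c.
Proof.
have UT : U `<=` fullO X by [].
by rewrite /ffcst /= -(germ_res UT I Ug) cst_res.
Qed.

Lemma germ_unit (U : opens X) (Ug : oset U (gpt K)) (s : sec U) :
  unit_at s (gpt K) -> germ K Ug s != 0.
Proof.
move=> [V [VU [t [Vg e]]]]; apply/eqP => s0.
have := congr1 (germ K Vg) e; rewrite rmorphM rmorph1 (germ_res VU Ug) s0 mul0r.
by move/eqP; rewrite eq_sym oner_eq0.
Qed.

Lemma affine_basic_nbhd (U V : opens X) :
  affine_open U -> oset U (gpt K) -> oset V (gpt K) ->
  exists s : sec U, oset (basic_open s) (gpt K) /\ basic_open s `<=` V.
Proof.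
move=> [_ _ basis _] Ug Vg.
pose W : opens X := Opens (openI (oset_open U) (oset_open V)).
have [|s [us sub]] := basis W (gpt K) _ (conj Ug Vg); first by move=> y [].
by exists s; split=> // y /sub[].
Qed.

(** Take the germs of algebra generators of an affine chart around the generic point. Every germ is
    defined on some $D(t)$ in this chart, where sections are fractions $b/t^m$. *)
Lemma function_field_fg : finite_type X -> exists B : seq K, 
  forall S : set K, is_subfield S -> range (ffcst K) `<=` S ->
    (forall b, b \in B -> S b) -> S = setT.
Proof.
move=> [n [U [aff cov]]]; have [i Ug] := cov (gpt K).
have [affU [B0 [/finite_seqP[B ->{B0}] genB]]] := aff i.
exists (map (germ K Ug) B) => S Sf Sk SB.
have [S1 SBB SV] := Sf.
have gS s : S (germ K Ug s).
  have : [set: sec (U i)] s by []; rewrite -genB; move: s.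
  apply: (@smallest_sub _ _ _ [set s | S (germ K Ug s)]); last first.
    move=> s [[c _ <-]|sB]; first by rewrite /= germ_cst; apply: Sk; exists c.
    by apply: SB; apply: map_f.
  split=> [|s t|s t]; rewrite !inE /= ?rmorph1 ?rmorphB ?rmorphM.
  - by rewrite inE in S1.
  - by move=> Ss St; have := SBB _ _ (mem_set Ss) (mem_set St); rewrite inE.
  move=> Ss St; have := GRing.divring_closedBM Sf => -[_ _ SM].
  by have := SM _ _ (mem_set Ss) (mem_set St); rewrite inE.
apply/seteqP; split=> // a _; have [V [Vg [s <-]]] := germ_surj a.
have [t [tg tV]] := affine_basic_nbhd affU Ug Vg.
have [_ _ _ loc] := affU.
have [_ /(_ (res tV s)) [m [b e]] _] := loc t _ (@basic_open_sub X (U i) t) erefl.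
have := congr1 (germ K tg) e.
rewrite rmorphM rmorphXn /= !(germ_res _ Ug) (germ_res _ Vg) => gE.
have t0 : germ K Ug t != 0 by apply: germ_unit; case: tg.
have -> : germ K Vg s = germ K Ug b / germ K Ug (t ^+ m).
  by rewrite -gE rmorphXn mulrC mulKf // expf_neq0.
by have := SV _ _ (mem_set (gS b)) (mem_set (gS (t ^+ m))); rewrite inE.
Qed.

(** A section with zero germ vanishes on some nonempty $D(t)$, so a power of [t] kills it, and the
    sections over [U] form a domain. *)
Lemma germ_inj (U : opens X) (Ug : oset U (gpt K)) (s : sec U) :
  integral_scheme X -> affine_open U -> germ K Ug s = 0 -> s = 0.
Proof.
move=> [_ intX] affU /germ_eq0 [V [VU [Vg s0]]].
have [t [tg tV]] := affine_basic_nbhd affU Ug Vg.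
have [_ _ _ loc] := affU.
have [_ _ /(_ s)[|m e]] := loc t _ (@basic_open_sub X U t) erefl.
  by rewrite -(res_comp VU tV) s0 rmorph0.
have [|_ domU] := intX U; first by exists (gpt K).
have t0 : germ K Ug t != 0 by apply: germ_unit; case: tg.
elim: m e => [|m IH]; first by rewrite mul1r.
rewrite exprS -mulrA => /domU[te|/IH//].
by move: t0; rewrite te rmorph0 eqxx.
Qed.

End FunctionField.

(** Divide a relation for [a] by the power of ['X] in it. The constant term is then nonzero, and
    solving for it gives $a^{-1}$ as a polynomial in $a$. *)
Lemma algebraic_inverse (F E : fieldType) (f : {rmorphism F -> E}) (a : E) :
  a != 0 -> algebraicOver f a -> exists q : {poly F}, a * (map_poly f q).[a] = 1.
Proof.
move=> a0 [p p0 pa].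
have [m [q]] := multiplicity_XsubC p 0; rewrite p0 subr0 /= => q0 pE.
have {pa} qa : root (map_poly f q) a.
  move: pa; rewrite pE rmorphM rmorphXn /= map_polyX rootM => /orP[//|].
  by rewrite /root hornerXn expf_eq0 (negbTE a0) andbF.
have /factor_theorem[r] : root (q - q.[0]%:P) 0 by rewrite /root !hornerE subrr.
rewrite subr0 => qE; exists (- (q.[0])^-1 *: r).
rewrite map_polyZ /= hornerZ mulrCA rmorphN fmorphV /=.
have -> : a * (map_poly f r).[a] = - f q.[0].
  move: qa; rewrite -(subrK q.[0]%:P q) qE rmorphD rmorphM /= map_polyX map_polyC.
  by rewrite /root !hornerE [_ * a]mulrC addr_eq0 => /eqP.
by rewrite mulrNN mulVf // fmorph_eq0.
Qed.

(** If [K] were algebraic over [k], a section over an affine open with nonzero generic germ would be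
    invertible there, so every point would be generic. The smaller member of a chain of two
    irreducible closed sets would then be the whole space. *)
Lemma curve_transcendental (k : fieldType) (X : kscheme k) (K : function_field X) :
  curve X -> exists t : K, ~ algebraicOver (ffcst K) t.
Proof.
move=> [_ gint _ _ [[c [irr mono]] _]]; apply: contrapT => alg.
have {}alg t : algebraicOver (ffcst K) t.
  by apply: contrapT => nt; apply: alg; exists t.
have intX : integral_scheme X := gint _ _ _ _ (base_change_id X).
have [cl0 [x c0x] _] := irr ord0.
have [U [Ux affU]] := scheme_affine x.
have Ug : oset U (gpt K) := gpt_open K Ux.
have [spec prim _ _] := affU.
have Px : [set s : sec U | ~ unit_at s x] = [set s | ~ unit_at s (gpt K)].
  apply/seteqP; split=> s /= nu us; apply: nu; last first.
    have [V [VU [t [Vx e]]]] := us.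
    by exists V, VU, t; split=> //; exact: gpt_open Vx.
  have [q qE] := algebraic_inverse (germ_unit Ug us) (alg _).
  (* The polynomial formula for the inverse germ makes sense over all of [U], and there $sw = 1$
     because germs are injective. *)
  pose w : sec U := \sum_(i < size q) Defs.cst U q`_i * s ^+ i.
  exists U, (@subset_refl _ U), w; split=> //; rewrite res_id; apply/eqP.
  rewrite -subr_eq0; apply/eqP; apply: (germ_inj (Ug := Ug) intX affU).
  rewrite rmorphB rmorphM rmorph1 /w rmorph_sum /= -qE horner_coef.
  rewrite size_map_poly; apply/eqP; rewrite subr_eq0; apply/eqP; congr (_ * _).
  apply: eq_bigr => i _; rewrite rmorphM rmorphXn germ_cst coef_map; congr (_ * _).
(* Points of an affine open are determined by their primes. *)
have [y [_ yuniq]] := spec _ (prim x Ux).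
have xg : x = gpt K.
  by rewrite -(yuniq x) // (yuniq (gpt K)) //; split.
have c0T : c ord0 = setT.
  apply/seteqP; split=> // z _; apply: cl0 => B zB.
  have : closure [set gpt K] z by rewrite gptP.
  by move=> /(_ B zB)[_ [-> By]]; exists (gpt K); split; rewrite -?xg // xg.
have [_] : c ord0 `<` c (lift ord0 ord0) by exact: mono.
by rewrite c0T; apply.
Qed.

(** * Stabilizers in automorphism groups *)

Section Automorphisms.
Variables (E : fieldType) (F : set E).
Implicit Types (s t : aut F) (S : set E).

Lemma aut_mulE s t x : (s * t)%g x = s (t x). Proof. by []. Qed.

Lemma aut_invK s : cancel (s^-1)%g s.
Proof. by move=> x; rewrite -aut_mulE mulgV. Qed.

Lemma aut_invKV s : cancel s (s^-1)%g.
Proof. by move=> x; rewrite -aut_mulE mulVg. Qed.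

Lemma open_autE (U : set (aut F)) : open U = aut_open U. Proof. by []. Qed.

Lemma subgroupP (H : set (aut F)) : subgroup H <->
  [/\ H 1%g, (forall s t, H s -> H t -> H (s * t)%g) & (forall s, H s -> H s^-1%g)].
Proof.
split=> [[H1 Hd]|[H1 HM HV]].
  rewrite inE in H1; have HV s : H s -> H s^-1%g.
    by move=> Hs; have := Hd 1%g s; rewrite !inE mul1g; apply.
  by split=> // s t Hs /HV Ht; have := Hd s t^-1%g; rewrite !inE invgK; apply.
by split; rewrite ?inE // => s t; rewrite !inE => Hs /HV; exact: HM.
Qed.

Lemma subgroup_generated (B : set (aut F)) : subgroup (generated B).
Proof.
apply/subgroupP; split=> [|s t Gs Gt|s Gs] H [] Hg BH;
  have [H1 HM HV] := (subgroupP _).1 Hg.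
- exact: H1.
- by apply: HM; [apply: Gs | apply: Gt].
- by apply: HV; apply: Gs.
Qed.

Lemma subgroup_fixing S : subgroup (fixing S : set (aut F)).
Proof.
apply/subgroupP; split=> [x //|s t fs ft x Sx|s fs x Sx].
  by rewrite aut_mulE ft // fs.
by rewrite -{1}(fs x Sx) aut_invKV.
Qed.

Section Fixing.
Variables (K : fieldType) (x : {rmorphism K -> E}).

(** A subgroup containing the pointwise stabilizer of a finite set is open. *)
Lemma fixing_open (B : seq K) :
  (forall s, (forall b, b \in B -> s (x b) = x b) -> fixing (range x) s) ->
  open (fixing (range x) : set (aut F)).
Proof.
rewrite open_autE => gen s fs; exists (map x B) => t tB.
have [_ HM _] := (subgroupP _).1 (subgroup_fixing (range x)).
by apply: HM => //; apply: gen => b bB; apply: tB; exact: map_f.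
Qed.

(** An ultrafilter contains each fibre or its complement, so the candidates in [r] can be discarded
    one by one. *)
Lemma ultra_pick (T : Type) (A : eqType) (U : set_system T) (f : T -> A)
    (r : seq A) :
  UltraFilter U -> U [set s | f s \in r] -> exists y, U [set s | f s = y].
Proof.
move=> UU; elim: r => [|a r IH] Ur.
  by have /filter_ex[s] : U [set s | f s \in [::]] by [].
have [|Ua] := in_ultra_setVsetC [set s | f s = a] UU; first by exists a.
apply: IH; apply: filterS (filterI Ur Ua) => s [/=].
by rewrite inE => /orP[/eqP //|].
Qed.

Lemma ultra_seq (T : Type) (A : eqType) (U : set_system T) (P : A -> T -> Prop)
    (r : seq A) :
  UltraFilter U -> (forall a, U (P a)) -> U [set s | forall a, a \in r -> P a s].
Proof.
move=> UU UP; elim: r => [|a r IH]; first by apply: filterS filterT.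
apply: filterS (filterI (UP a) IH) => s [Pa Pr] b.
by rewrite inE => /orP[/eqP ->|/Pr].
Qed.

(* An ultrafilter on the stabilizer converges pointwise, as the orbit of each
   element consists of roots of one polynomial; the pointwise limit is a ring
   morphism, inverted by the pointwise limit of the inverses. *)
Lemma fixing_compact : (forall e, algebraicOver x e) ->
  compact (fixing (range x) : set (aut F)).
Proof.
move=> alg; rewrite compact_ultra => U UU UH.
have [_ _ HV] := (subgroupP _).1 (@subgroup_fixing (range x)).
have orbit e : exists r : seq E, forall s, fixing (range x) s -> s e \in r.
  have [p p0 pe] := alg e; have [|r rP] := @roots_seq _ (map_poly x p).
    by rewrite map_poly_eq0.
  exists r => s fs; apply: rP.
  have : root (map_poly s (map_poly x p)) (s e) by rewrite fmorph_root.
  congr (root _ _); rewrite -map_poly_comp; apply: eq_map_poly => c /=.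
  by apply: fs; exists c.
have ex e : exists y, U [set s : aut F | s e = y].
  have [r rP] := orbit e; apply: (@ultra_pick _ _ _ (fun s : aut F => s e) r).
  by apply: filterS UH => s; exact: rP.
have exV e : exists y, U [set s : aut F | s^-1%g e = y].
  have [r rP] := orbit e; apply: (@ultra_pick _ _ _ (fun s : aut F => s^-1%g e) r).
  by apply: filterS UH => s /HV; exact: rP.
pose l e := projT1 (cid (ex e)).
have lP e : U [set s : aut F | s e = l e] by exact: (projT2 (cid (ex e))).
pose m e := projT1 (cid (exV e)).
have mP e : U [set s : aut F | s^-1%g e = m e] by exact: (projT2 (cid (exV e))).
have lB : zmod_morphism l.
  move=> a b; have [s [[<- <-] <-]] :=
    filter_ex (filterI (filterI (lP (a - b)) (lP a)) (lP b)).
  by rewrite rmorphB.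
have lM : monoid_morphism l.
  split; first by have [s <-] := filter_ex (lP 1); rewrite rmorph1.
  move=> a b; have [s [[<- <-] <-]] :=
    filter_ex (filterI (filterI (lP (a * b)) (lP a)) (lP b)).
  by rewrite rmorphM.
have lmK : cancel m l.
  move=> a; have [s [<- ms]] := filter_ex (filterI (lP (m a)) (mP a)).
  by rewrite -ms aut_invK.
have mlK : cancel l m.
  move=> a; have [s [<- ls]] := filter_ex (filterI (mP (l a)) (lP a)).
  by rewrite -ls aut_invKV.
have lF a : F a -> l a = a.
  by move=> Fa; have [s <-] := filter_ex (lP a); rewrite aut_fix.
pose l1 := GRing.isZmodMorphism.Build E E l lB.
pose l2 := GRing.isMonoidMorphism.Build E E l lM.
pose lr : {rmorphism E -> E} := HB.pack l l1 l2.
have lbij : bijective lr by exists m.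
pose L : aut F := FieldAut lbij lF.
exists L; split.
  move=> _ [c _ <-]; have [s [fs ls]] := filter_ex (filterI UH (lP (x c))).
  by rewrite -[LHS]/(l (x c)) -ls; apply: fs; exists c.
move=> V; rewrite nbhsE => -[W [oW WL] WV].
(* A neighbourhood of [L] contains $L\cdot\mathrm{Stab}(B)$ for a finite [B]; by finiteness, the
   ultrafilter contains the set of all [s] agreeing with [L] on [B], and for these $L^{-1}s$ fixes
   [B]. *)
have [B BP] : exists B : seq E, forall t : aut F,
    (forall e, e \in B -> t e = e) -> W (L * t)%g.
  by move: oW; rewrite open_autE => /(_ _ WL).
apply: filterS (ultra_seq B UU lP) => s sB; apply: WV.
rewrite -(mulVKg L s); apply: BP => e eB.
by rewrite aut_mulE sB //; exact: (aut_invKV L).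
Qed.

End Fixing.
End Automorphisms.

(** * The graph of translates *)

Section Joined.
Variable T : graph.
Implicit Types u v w : vertex T.

Lemma joined_refl v : joined v v. Proof. by exists [::]. Qed.

Lemma joined_sym v w : joined v w -> joined w v.
Proof. by move=> [p /walk_revP wp]; exists (walk_rev p). Qed.

Lemma joined_trans u v w : joined u v -> joined v w -> joined u w.
Proof.
by move=> [p wp] [q wq]; exists (p ++ q); apply/walk_cat; exists v.
Qed.

Lemma joined_edge (e : edge T) : joined (inl (bend e)) (inr (rend e)).
Proof. exact: joined_rend (joined_refl _). Qed.

End Joined.

Section Translates.
Variables (k E : fieldType) (iE : {rmorphism k -> E}) (F : set E).
Hypothesis kF : range iE `<=` F.

Lemma aut_cst (s : aut F) c : s (iE c) = iE c.
Proof. by apply: aut_fix; apply: kF; exists c. Qed.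

Definition aut_kemb (s : aut F) : kemb iE iE := Kemb (aut_cst s).

Definition translate (K : fieldType) (iK : {rmorphism k -> K}) (s : aut F)
  (y : kemb iK iE) : kemb iK iE := kemb_comp (aut_kemb s) y.

Section OneField.
Variables (K : fieldType) (iK : {rmorphism k -> K}).
Implicit Types y : kemb iK iE.

Lemma translate1 y : translate 1%g y = y.
Proof. exact: kemb_eq. Qed.

Lemma translateM s t y : translate (s * t)%g y = translate s (translate t y).
Proof. exact: kemb_eq. Qed.

Lemma fixing_range s y : fixing (range y) s <-> translate s y = y.
Proof.
split=> [fs|sy _ [c _ <-]]; first by apply: kemb_eq => c; apply: fs; exists c.
by rewrite -{2}sy.
Qed.

Lemma fixing_translate a s y :
  fixing (range (translate a y)) s <-> fixing (range y) (a^-1 * s * a)%g.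
Proof.
rewrite !fixing_range !translateM; split=> [->|e].
  by rewrite -translateM mulVg translate1.
by rewrite -[in RHS]e -!translateM !mulgA mulgV mul1g.
Qed.

(** The stabilizer of [translate a y] is the conjugate by [a] of that of [y]. It is thus a compact
    open subgroup of [A] containing [G], and maximality gives equality. *)
Lemma maximal_conjugate (A G : set (aut F)) a y :
  subgroup A -> A a -> fixing (range y) `<=` A ->
  compact (fixing (range (translate a y)) : set (aut F)) ->
  open (fixing (range (translate a y)) : set (aut F)) ->
  maximal_compact_open_subgroup A G -> G `<=` fixing (range (translate a y)) ->
  conjugate_in A G (fixing (range y)).
Proof.
move=> sA Aa fA cpt opn [_ Gmax] Gsub; have [_ AM AV] := (subgroupP _).1 sA.
exists a => //; rewrite -(Gmax _ _ Gsub).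
  apply/seteqP; split=> [s /fixing_translate fs|_ [h fh <-]].
    by exists (a^-1 * s * a)%g => //; rewrite !mulgA mulgV mul1g mulgK.
  by apply/fixing_translate; rewrite !mulgA mulVg mul1g mulgVK.
have subA : fixing (range (translate a y)) `<=` A.
  move=> s /fixing_translate/fA As.
  have -> : s = (a * (a^-1 * s * a) * a^-1)%g by rewrite !mulgA mulgV mul1g mulgK.
  by apply: (AM); [apply: (AM) | apply: (AV)].
split=> //; first exact: subgroup_fixing.
by exists (fixing (range (translate a y))); split=> //; rewrite setIidr.
Qed.

End OneField.
End Translates.

Lemma open_coset (E : fieldType) (F : set E) (x : aut F) (U : set (aut F)) :
  open U -> open [set s | U (x^-1 * s)%g].
Proof.
rewrite !open_autE => oU s /oU [B BP]; exists B => t tB /=.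
by rewrite mulgA; exact: BP.
Qed.

(** * The orbit of an edge under the group generated by the stabilizers of its ends *)

Section OrbitGraph.
Variables (k KX KY KZ E Omega : fieldType).
Variables (iX : {rmorphism k -> KX}) (iY : {rmorphism k -> KY}).
Variables (iZ : {rmorphism k -> KZ}) (iE : {rmorphism k -> E}).
Variables (iO : {rmorphism k -> Omega}).
Variables (fs : kemb iX iZ) (gs : kemb iY iZ) (R : kemb iZ iE).
Variables (j : kemb iE iO) (F : set E).
Hypothesis kF : range iE `<=` F.

Local Notation tr := (translate kF).
Local Notation P := (kemb_comp R fs).
Local Notation Q := (kemb_comp R gs).

Definition vertex_stabilizers : set (aut F) :=
  generated (fixing (range P) `|` fixing (range Q)).
Local Notation A := vertex_stabilizers.

Lemma subgroup_stabilizers : subgroup A. Proof. exact: subgroup_generated. Qed.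

Lemma stabilizers_sub : fixing (range P) `|` fixing (range Q) `<=` A.
Proof. exact: sub_gen_smallest. Qed.

(** The translating element is only asserted to exist, so equal embeddings give equal points of the
    orbit. *)
Definition translates (K : fieldType) (iK : {rmorphism k -> K}) (y : kemb iK iE) : Type :=
  {z : kemb iK iE | exists2 a, A a & z = tr a y}.

Definition translates_elt (K : fieldType) (iK : {rmorphism k -> K}) (y : kemb iK iE)
  a (Aa : A a) : translates y := exist _ (tr a y) (ex_intro2 _ _ a Aa erefl).

Lemma translates_eq (K : fieldType) (iK : {rmorphism k -> K}) (y : kemb iK iE)
  (u v : translates y) : sval u = sval v -> u = v.
Proof. by case: u v => [u Hu] [v Hv] /= e; exact: eq_exist. Qed.

Lemma translates_comp_subproof (K : fieldType) (iK : {rmorphism k -> K})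
  (h : kemb iK iZ) (e : translates R) :
  exists2 a, A a & kemb_comp (sval e) h = tr a (kemb_comp R h).
Proof.
by case: e => e [a Aa /= eE]; exists a => //; rewrite eE; exact: kemb_eq.
Qed.

Definition translates_comp (K : fieldType) (iK : {rmorphism k -> K}) (h : kemb iK iZ)
  (e : translates R) : translates (kemb_comp R h) :=
  exist _ _ (translates_comp_subproof h e).

Definition orbit_graph : graph :=
  @Graph (translates P) (translates Q) (translates R)
    (translates_comp fs) (translates_comp gs).

Lemma translates_act_subproof (K : fieldType) (iK : {rmorphism k -> K}) (y : kemb iK iE)
  h (Ah : A h) (u : translates y) : exists2 a, A a & tr h (sval u) = tr a y.
Proof.
case: u => u [a Aa /= uE]; exists (h * a)%g; last by rewrite uE translateM.
by have [_ AM _] := (subgroupP _).1 subgroup_stabilizers; exact: AM.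
Qed.

Definition translates_act (K : fieldType) (iK : {rmorphism k -> K}) (y : kemb iK iE)
  h (Ah : A h) (u : translates y) : translates y :=
  exist _ _ (translates_act_subproof Ah u).

Lemma translates_act_comp (K : fieldType) (iK : {rmorphism k -> K}) (g : kemb iK iZ)
  h (Ah : A h) (e : translates R) :
  translates_comp g (translates_act Ah e) = translates_act Ah (translates_comp g e).
Proof. by apply: translates_eq; exact: kemb_eq. Qed.

Definition act_hom h (Ah : A h) : graph_hom orbit_graph orbit_graph :=
  @GraphHom orbit_graph orbit_graph (@translates_act _ _ P h Ah)
    (@translates_act _ _ Q h Ah) (@translates_act _ _ R h Ah)
    (translates_act_comp fs Ah) (translates_act_comp gs Ah).

Lemma stabilizers1 : A 1%g.
Proof. by have [] := (subgroupP _).1 subgroup_stabilizers. Qed.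

Definition base_vertex : vertex orbit_graph := inl (translates_elt P stabilizers1).

Lemma translates_act_elt (K : fieldType) (iK : {rmorphism k -> K}) (y : kemb iK iE)
  h (Ah : A h) a (Aa : A a) (Aha : A (h * a)%g) :
  translates_act Ah (translates_elt y Aa) = translates_elt y Aha.
Proof. by apply: translates_eq; rewrite /= translateM. Qed.

(** The elements moving $P$ within its component form a subgroup, as [A] acts by graph morphisms. It
    contains the stabilizer of $P$, and also that of $Q$: if $aQ = Q$, then $R$ and $aR$ connect $P$
    to $aP$ through $Q$. *)
Lemma joined_base a (Aa : A a) : joined base_vertex (inl (translates_elt P Aa)).
Proof.
have [_ AM AV] := (subgroupP _).1 subgroup_stabilizers.
pose C := [set a | exists Aa : A a, joined base_vertex (inl (translates_elt P Aa))].
suff : A `<=` C.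
  by move=> /(_ a Aa)[Aa']; rewrite (Prop_irrelevance Aa' Aa).
apply: smallest_sub.
  apply/subgroupP; split=> [|s t [As Js] [At Jt]|s [As Js]].
  - by exists stabilizers1; exact: joined_refl.
  - exists (AM _ _ As At); apply: joined_trans Js _.
    have := joined_hom (act_hom As) Jt.
    rewrite /= (translates_act_elt _ _ _ (AM _ _ As At)).
    by congr (joined (inl _) _); apply: translates_eq; rewrite /= -translateM mulg1.
  - exists (AV _ As); apply: joined_sym; have := joined_hom (act_hom (AV _ As)) Js.
    congr (joined (inl _) (inl _)); apply: translates_eq; rewrite /= -translateM ?mulg1//.
    by rewrite mulVg.
move=> s fs'; have As : A s := stabilizers_sub fs'; exists As.
case: fs' => fs'.
  suff -> : translates_elt P As = translates_elt P stabilizers1 by exact: joined_refl.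
  by apply: translates_eq; rewrite /= translate1; apply/fixing_range.
have J t (At : A t) :
    joined (inl (translates_elt P At) : vertex orbit_graph) (inr (translates_elt Q At)).
  have := @joined_edge orbit_graph (translates_elt R At).
  by congr (joined (inl _) (inr _)); apply: translates_eq; exact: kemb_eq.
apply: joined_trans (J _ stabilizers1) _; apply: joined_sym.
suff -> : translates_elt Q stabilizers1 = translates_elt Q As by exact: J.
by apply: translates_eq; rewrite /= translate1; apply/esym/fixing_range.
Qed.

Lemma orbit_graph_connected (v w : vertex orbit_graph) : joined v w.
Proof.
suff J u : joined base_vertex u by apply: joined_trans (joined_sym (J v)) (J w).
case: u => [u|u]; case: (u) => z [a Aa zE].
  have -> : exist _ z (ex_intro2 _ _ a Aa zE) = translates_elt P Aa by exact: translates_eq.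
  exact: joined_base.
have -> : exist _ z (ex_intro2 _ _ a Aa zE) = @rend orbit_graph (translates_elt R Aa).
  by apply: translates_eq; rewrite /= zE; exact: kemb_eq.
apply: joined_rend.
have -> : @bend orbit_graph (translates_elt R Aa) = translates_elt P Aa.
  by apply: translates_eq; exact: kemb_eq.
exact: joined_base.
Qed.

Local Notation generic := (full_generic_graph iO fs gs).

Lemma push_comp (K : fieldType) (iK : {rmorphism k -> K}) (g : kemb iK iZ)
  (e : translates R) :
  kemb_comp (kemb_comp j (sval e)) g = kemb_comp j (sval (translates_comp g e)).
Proof. exact: kemb_eq. Qed.

Definition push_hom : graph_hom orbit_graph generic :=
  @GraphHom orbit_graph generic (fun u => kemb_comp j (sval u))
    (fun u => kemb_comp j (sval u)) (fun u => kemb_comp j (sval u))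
    (push_comp fs) (push_comp gs).

Local Notation v0 := (inl (vP fs (kemb_comp j R)) : vertex generic).

Lemma joined_push v : joined v0 (hom_vertex push_hom v).
Proof.
have -> : v0 = hom_vertex push_hom base_vertex by congr inl; exact: kemb_eq.
exact: joined_hom (orbit_graph_connected _ _).
Qed.

Lemma joined_push_edge e : joined v0 (inl (bend (hom_edge push_hom e))).
Proof. by rewrite hom_bend; exact: (joined_push (inl (bend e))). Qed.

(** Kept transparent, since the injectivity of its three maps is read off from their values. *)
Definition component_hom : graph_hom orbit_graph (component v0).
Proof.
refine (@GraphHom orbit_graph (component v0)
  (fun u => exist _ (hom_blue push_hom u) (joined_push (inl u)))
  (fun u => exist _ (hom_red push_hom u) (joined_push (inr u)))
  (fun u => exist (fun e => joined v0 (inl (bend e))) _ (joined_push_edge u)) _ _).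
- by move=> e; apply: eq_exist; exact: hom_bend.
- by move=> e; apply: eq_exist; exact: hom_rend.
Defined.

Lemma push_inj (K : fieldType) (iK : {rmorphism k -> K}) (y : kemb iK iE)
  (u v : translates y) : kemb_comp j (sval u) = kemb_comp j (sval v) -> u = v.
Proof.
move=> e; apply: translates_eq; apply: kemb_eq => x; apply: (fmorph_inj j).
by have := congr1 (fun h : kemb iK iO => h x) e.
Qed.

Hypothesis acyclic : ~ exists v p, @circuit (component v0) v p.

Lemma orbit_graph_acyclic : ~ exists v p, @circuit orbit_graph v p.
Proof.
move=> [v [p c]]; apply: acyclic; exists (hom_vertex component_hom v).
exists (map (hom_dart component_hom) p); apply: circuit_hom c => u w /(congr1 sval);
  exact: push_inj.
Qed.

(** The fixed vertex theorem is applied to the action of [G] on the orbit graph, with [S] the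
    [G]-orbit of $P$. *)
Lemma compact_fixed_vertex (G : set (aut F)) :
  subgroup G -> G `<=` A -> compact G -> open (fixing (range P) : set (aut F)) ->
  (exists2 a, A a & G `<=` fixing (range (tr a P))) \/
  (exists2 a, A a & G `<=` fixing (range (tr a Q))).
Proof.
move=> /subgroupP[G1 GM GV] GA cptG oP.
pose H : set (graph_hom orbit_graph orbit_graph) :=
  [set h | exists s (As : A s), G s /\ h = act_hom As].
pose S : set (vertex orbit_graph) :=
  [set v | exists s (As : A s), G s /\ v = inl (translates_elt P As)].
have [v vP] : exists v, forall h, H h -> hom_vertex h v = v.
  apply: (@tree_fixed_vertex _ H S orbit_graph_acyclic orbit_graph_connected).
  - by exists base_vertex, 1%g, stabilizers1.
  (* Compactness in near-covering form, with bounds [n] tending to infinity: a bound on walk lengths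
     near each point of [G] yields one for all of [G]. *)
  - have /compact_near_coveringP/(_ _ \oo (fun n s => forall As : A s, exists p,
      @walk orbit_graph base_vertex p (inl (translates_elt P As)) /\
      (size p <= n)%N)) := cptG.
    case=> [x Gx|n _ /(_ n (leqnn n)) Hn].
      have Ax := GA x Gx.
      have [p wp] := orbit_graph_connected base_vertex (inl (translates_elt P Ax)).
      (* On the open coset $x\,\mathrm{Stab}(P)$ the vertex $sP$ is constantly $xP$, so one walk
         serves all [s] there. *)
      exists ([set s | fixing (range P) (x^-1 * s)%g], [set n | (size p <= n)%N]) => /=.
        split; last by exists (size p).
        apply: open_nbhs_nbhs; split; first exact: open_coset.
        by rewrite /= mulVg => y.
      move=> [s n] /= [fsx pn] As; exists p; split=> //.
      have sx := (fixing_range kF _ P).1 fsx.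
      suff -> : translates_elt P As = translates_elt P Ax by [].
      apply: translates_eq => /=; rewrite -[in RHS]sx -translateM.
      by rewrite mulgA mulgV mul1g.
    by exists n, base_vertex => _ [s [As [Gs ->]]]; exact: Hn.
  - move=> _ [h [Ah [Gh ->]]] _ [s [As [Gs ->]]].
    (* The vertex $sP$ is the image under [h] of $h^{-1}sP$. *)
    have Gt : G (h^-1 * s)%g by apply: GM => //; exact: GV.
    exists (inl (translates_elt P (GA _ Gt))); first by exists (h^-1 * s)%g, (GA _ Gt).
    by congr inl; apply: translates_eq; rewrite /= -translateM mulgA mulgV mul1g.
have {}vP s (Gs : G s) : hom_vertex (act_hom (GA s Gs)) v = v.
  by apply: vP; exists s, (GA s Gs).
case: v vP => [[z [a Aa zE]]|[z [a Aa zE]]] vP; [left|right]; exists a => // s Gs;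
  by apply/(fixing_range kF); have [] := vP s Gs; rewrite zE.
Qed.

End OrbitGraph.

(** * Application to the function fields of the curves *)

Lemma rmorph_lift (L K : fieldType) (S : set L) (HS : is_subfield S)
    (h : {rmorphism K -> L}) : (forall x, S (h x)) ->
  exists h' : {rmorphism K -> subfield_type HS}, forall x, val (h' x) = h x.
Proof.
move=> hS; pose l x : subfield_type HS := exist _ (h x) (mem_set (hS x)).
have lB : zmod_morphism l by move=> x y; apply: val_inj; rewrite /= rmorphB.
have lM : monoid_morphism l.
  by split=> [|x y]; apply: val_inj; rewrite /= ?rmorph1 ?rmorphM.
pose l1 := GRing.isZmodMorphism.Build K (subfield_type HS) l lB.
pose l2 := GRing.isMonoidMorphism.Build K (subfield_type HS) l lM.
by exists (HB.pack l l1 l2 : {rmorphism K -> subfield_type HS}).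
Qed.

(** The elements of [K] whose images are fixed by [s] form a subfield containing [k], so fixing the
    images of finitely many generators suffices. *)
Lemma curve_stabilizer_open (k E : fieldType) (iE : {rmorphism k -> E}) (F : set E)
    (X : kscheme k) (K : function_field X) (y : kemb (ffcst K) iE) :
  range iE `<=` F -> curve X -> open (fixing (range y) : set (aut F)).
Proof.
move=> kF [_ _ _ /(function_field_fg K)[B gen] _].
apply: (@fixing_open _ _ _ _ B) => s sB _ [x _ <-].
suff : [set x | s (y x) = y x] = setT by move/seteqP => [_ /(_ x I)].
apply: gen => // [|_ [c _ <-]]; last first.
  by rewrite /= emb_cst; apply: aut_fix; apply: kF; exists c.
split; first by rewrite inE /= !rmorph1.
  by move=> a b; rewrite !inE /= !rmorphB => -> ->.
by move=> a b; rewrite !inE /= !(rmorphM, fmorphV) => -> ->.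
Qed.

(** [Omega] is algebraic over the copy of [K] in it, and injectivity of [j] brings the relations
    back to [E]. *)
Lemma curve_stabilizer_compact (k E Omega : fieldType) (iE : {rmorphism k -> E})
    (iO : {rmorphism k -> Omega}) (j : kemb iE iO) (F : set E)
    (X : kscheme k) (K : function_field X) (y : kemb (ffcst K) iE) :
  has_trdeg (range iO) setT 1 -> curve X -> compact (fixing (range y) : set (aut F)).
Proof.
move=> trO /(curve_transcendental K)[t nt]; apply: fixing_compact => e.
have [p p0 pe] := trdeg1_algebraic (kemb_comp j y) trO nt (j e).
exists p => //; move: pe; rewrite -(fmorph_root j) /=.
by congr (root _ _); rewrite -map_poly_comp.
Qed.

Theorem corollary5p21 (k : fieldType) (X Y Z : kscheme k)
    (f : mor Z X) (g : mor Z Y)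
    (KX : function_field X) (KY : function_field Y) (KZ : function_field Z)
    (fs : kemb (ffcst KX) (ffcst KZ)) (gs : kemb (ffcst KY) (ffcst KZ))
    (curveX : curve X) (curveY : curve Y) (curveZ : curve Z)
    (kf : kmor f) (kg : kmor g)
    (finf : finite_mor f) (fing : finite_mor g)
    (pullf : is_pullback f fs) (pullg : is_pullback g gs)
    (sepf : generically_separable fs) (sepg : generically_separable gs)
    (minfg : minimal fs gs) (nocore : without_core fs gs)
    (hypZ : hyperbolic Z \/ is_Fp_bar k)
    (Omega : fieldType) (iO : {rmorphism k -> Omega})
    (closedO : GRing.closed_field_axiom Omega)
    (trdegO : has_trdeg (range iO) setT 1)
    (PQ : kemb (ffcst KZ) iO)
    (tree : is_tree (generic_graph fs gs PQ))
    (G : set (AutkE fs gs PQ)) :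
  maximal_compact_open_subgroup (APQ fs gs PQ) G ->
  conjugate_in (APQ fs gs PQ) G (GP fs gs PQ) \/
  conjugate_in (APQ fs gs PQ) G (GQ fs gs PQ).
Proof.
have PQ_sub x : Einfty_set fs gs PQ (PQ x) by apply: sub_gen_smallest; exists x.
(* The constants and [PQ] take values in [Einfty_set]; their corestrictions [iE] and [R], with the
   inclusion [j], factor [PQ] as [j] after [R]. *)
have [|iE iEE] := rmorph_lift (Einfty_subfield fs gs PQ) (h := iO).
  by move=> c; rewrite -(emb_cst PQ).
have [R0 R0E] := rmorph_lift (Einfty_subfield fs gs PQ) PQ_sub.
have R0k c : R0 (ffcst KZ c) = iE c by apply: val_inj; rewrite R0E iEE emb_cst.
pose R : kemb (ffcst KZ) iE := Kemb R0k.
pose j : kemb iE iO :=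
  @Kemb _ _ _ iE iO (val : {rmorphism Einfty fs gs PQ -> Omega}) iEE.
have PQE : PQ = kemb_comp j R by apply: kemb_eq => x; rewrite /= R0E.
have kF : range iE `<=` @Einfty_val _ _ _ _ _ _ _ _ _ fs gs PQ @^-1` range iO.
  by move=> _ [c _ <-]; exists c; rewrite // -iEE.
(* Turns [GP] and [GQ] into stabilizers of embeddings into [Einfty]. *)
have lift_range (K : fieldType) (iK : {rmorphism k -> K}) (h : kemb iK (ffcst KZ)) :
    @Einfty_val _ _ _ _ _ _ _ _ _ fs gs PQ @^-1` range (kemb_comp PQ h) =
    range (kemb_comp R h).
  apply/seteqP; split=> [e [x _ xe]|_ [x _ <-]]; exists x => //=.
    by apply: val_inj; rewrite R0E; exact: xe.
  by rewrite /Einfty_val R0E.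
have GPE : GP fs gs PQ = fixing (range (kemb_comp R fs)).
  by rewrite /GP -lift_range.
have GQE : GQ fs gs PQ = fixing (range (kemb_comp R gs)).
  by rewrite /GQ -lift_range.
rewrite /APQ GPE GQE -/(vertex_stabilizers fs gs R _) => Gmax.
have [[sG GA cptG _] _] := Gmax.
have acyclic : ~ exists v p, @circuit (generic_graph fs gs (kemb_comp j R)) v p.
  by rewrite -PQE; case: tree.
have [[a Aa Ga]|[a Aa Ga]] := compact_fixed_vertex kF acyclic sG GA cptG
    (curve_stabilizer_open kF curveX); [left|right].
  apply: (maximal_conjugate (subgroup_stabilizers _ _ _ _) Aa _ _ _ Gmax Ga).
  - by move=> s ?; apply: stabilizers_sub; left.
  - exact: (curve_stabilizer_compact j).
  - exact: curve_stabilizer_open.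
apply: (maximal_conjugate (subgroup_stabilizers _ _ _ _) Aa _ _ _ Gmax Ga).
- by move=> s ?; apply: stabilizers_sub; right.
- exact: (curve_stabilizer_compact j).
- exact: curve_stabilizer_open.
Qed.
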